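(* Let $\Omega \subset \mathbb{R}^n$, $n\geq 2$, be a bounded, convex domain which satisfies the interior sphere property. Let $q \in [0,1)$ and $\gamma \in [0,1]$. Let $u\in C^2_x(\Omega)\cap C^1_x(\overline{\Omega}) \cap C^1_t((0,+\infty)) \cap C(\overline{\Omega}\times[0,+\infty))$ be a positive solution of $$\begin{cases} u_t-\Delta u=a(x) t^{\gamma} u^q &\text{in }\Omega\times (0,+\infty), \\ u=0 & \text{on }\partial \Omega\times [0,+\infty), \\ u =0 & \text{on } \overline{\Omega} \times \{0\}. \end{cases}$$ Suppose $a\colon \Omega \to \mathbb{R}$ is measurable and that there exists $m>0$ such that $a(x)\geq m$ for all $x\in \Omega$. If $\beta \in [1, \frac{1}{\gamma}) \cap [1,2]$ and $a$ is $\theta$-concave with $\theta \geq \frac{1}{1-\beta \gamma}$, then the function $(x,t)\mapsto u(x, t^{\beta})$ is $\frac{(1-q)\theta}{2\theta +\beta \gamma \theta+1}$-concave. If $\beta \in [1, \min\{\frac{1}{\gamma},2\}]$ and $a$ is constant, then $(x,t)\mapsto u(x,t^{\beta})$ is $\frac{1-q}{2+\beta \gamma }$-concave.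
   Context: Convention: $1/\gamma=+\infty$ when $\gamma=0$. $\Omega$ (open) satisfies the interior sphere property if for all $x\in\partial\Omega$ there exist $y\in\Omega$ and $r>0$ such that $B_r(y)\subseteq\Omega$ and $x\in\partial B_r(y)$. $u\in C^k_x(A)$ means $u(\cdot,t)\in C^k(A)$ for each $t>0$; $u\in C^1_t((0,+\infty))$ means $u(x,\cdot)\in C^1((0,+\infty))$ for each $x\in\Omega$. A solution is positive when $u>0$ in $\Omega\times(0,+\infty)$. For $0<\alpha<+\infty$, a nonnegative function $w$ on a convex set is $\alpha$-concave if $w^\alpha$ is concave (for functions of $(x,t)$, jointly in $(x,t)$). *)

(* Defs.v *)
From HB Require Import structures.
From mathcomp Require Import all_boot all_order all_algebra.
From mathcomp Require Import all_classical all_reals all_analysis.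
Import Order.TTheory GRing.Theory Num.Theory numFieldNormedType.Exports.

Set Implicit Arguments.
Unset Strict Implicit.
Unset Printing Implicit Defensive.

Local Open Scope classical_set_scope.
Local Open Scope ring_scope.
Local Open Scope convex_scope.

(* The library norm on 'rV[R]_n is the sup norm: it induces the usual topology
   and the usual bounded sets, but the balls of the interior sphere property
   must be Euclidean. *)
Definition eucl_norm (R : realType) (n : nat) (x : 'rV[R]_n) : R :=
  Num.sqrt (\sum_(i < n) (x ord0 i) ^+ 2).

Definition eucl_ball (R : realType) (n : nat) (y : 'rV[R]_n) (r : R) :
  set 'rV[R]_n := [set x | eucl_norm (x - y) < r].

Definition boundary (T : topologicalType) (A : set T) : set T :=
  closure A `\` interior A.

Definition interior_sphere (R : realType) (n : nat) (Omega : set 'rV[R]_n) :=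
  forall x, boundary Omega x -> exists y r,
    [/\ Omega y, 0 < r, eucl_ball y r `<=` Omega & boundary (eucl_ball y r) x].

Definition domain (R : realType) (n : nat) (Omega : set 'rV[R]_n) :=
  [/\ open Omega, Omega !=set0 & connected Omega].

Section regularity.
Context (R : realType) (n : nat).
Implicit Types (Omega : set 'rV[R]_n) (f : 'rV[R]_n -> R).

Definition partial (i : 'I_n) f : 'rV[R]_n -> R := 'D_(delta_mx ord0 i) f.

Definition has_partial (i : 'I_n) f (x : 'rV[R]_n) :=
  derivable f x (delta_mx ord0 i).

Definition laplacian f (x : 'rV[R]_n) : R :=
  \sum_(i < n) partial i (partial i f) x.

(* C^k on an open set: only the values of f on Omega matter. *)
Fixpoint Ck (k : nat) Omega f : Prop :=
  (forall x, Omega x -> {for x, continuous f}) /\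
  if k is k'.+1 then
    forall i, (forall x, Omega x -> has_partial i f x) /\
              Ck k' Omega (partial i f)
  else True.

(* C^1 up to the boundary of the open set Omega: the first derivatives, defined
   in Omega, extend continuously to the closure. *)
Definition C1_closure Omega f : Prop :=
  [/\ Ck 1 Omega f,
      {within closure Omega, continuous f} &
      forall i, exists g : 'rV[R]_n -> R,
        {within closure Omega, continuous g} /\
        (forall x, Omega x -> g x = partial i f x)].

Definition C1_pos (h : R -> R) : Prop :=
  forall t, 0 < t -> derivable h t 1 /\ {for t, continuous (derive1 h)}.

End regularity.

Section lebesgue_measurability.
Context (R : realType) (n : nat).

Definition box (ab : 'rV[R]_n * 'rV[R]_n) : set 'rV[R]_n :=
  [set x | forall i, ab.1 ord0 i < x ord0 i <= ab.2 ord0 i].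

Definition box_volume (ab : 'rV[R]_n * 'rV[R]_n) : R :=
  \prod_(i < n) Num.max 0 (ab.2 ord0 i - ab.1 ord0 i).

Definition lebesgue_outer (X : set 'rV[R]_n) : \bar R :=
  ereal_inf [set (\sum_(0 <= k <oo) (box_volume (ab k))%:E)%E |
    ab in [set ab : nat -> 'rV[R]_n * 'rV[R]_n |
      X `<=` \bigcup_k box (ab k)]].

(* Lebesgue measurability of a : D -> R; a is only looked at on D. *)
Definition lebesgue_measurable_fun (D : set 'rV[R]_n) (a : 'rV[R]_n -> R) :=
  forall B : set R, measurable B ->
    (lebesgue_outer).-caratheodory (D `&` a @^-1` B).

End lebesgue_measurability.

(* Mirrors the library's [convex_function]. *)
Definition concave_function (R : realType) (E : lmodType R)
    (E' := convex_lmodType E) (D : set E') (f : E' -> R^o) :=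
  forall t : {i01 R},
    {in D &, forall x y : E', (f x <| t |> f y <= f (x <| t |> y))%R}.

Definition alpha_concave (R : realType) (E : lmodType R) (alpha : R)
    (D : set E) (w : E -> R) : Prop :=
  [/\ 0 < alpha,
      forall x, D x -> 0 <= w x &
      concave_function D (fun x => w x `^ alpha)].

(* Main.v *)
Require Import Defs.
From mathcomp Require Import all_boot all_order all_algebra ring lra.
From mathcomp Require Import all_classical all_reals all_analysis.
Import Order.TTheory GRing.Theory Num.Theory numFieldNormedType.Exports.

Local Open Scope classical_set_scope.
Local Open Scope ring_scope.

(* With [g = beta * gamma], [omega = 1 / theta] (and [omega = 0] for constant
   [a]) and [alpha = (1 - q) / (2 + g + omega)], the function
   [v (x, t) = u (x, t ^ beta) ^ alpha] satisfies
     [- Delta v = (1 / alpha - 1) |grad v|^2 / v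
        + alpha a t^g v^(- (1 + g + omega)) - t^(1 - beta) v_t / beta].
   For fixed [l] the concavity function
   [l v(z1) + (1 - l) v(z3) - v(l z1 + (1 - l) z3)] attains its maximum over a
   compact cylinder.  At a positive interior maximum the gradients agree, the
   time derivatives at [z1] and [z3] dominate the one in the middle, which is
   nonnegative because [u] is nondecreasing in time, and moving the three points
   by steps proportional to [v(z1)], [v(z3)] and their mean contradicts the
   equation: [a t^g v^(1 - g - omega)] is concave and [v^2 t^(1 - beta)] is
   convex since [1 <= beta <= 2].  The maximum is not attained when exactly one
   of [z1], [z3] lies on the parabolic boundary, because there [v] grows faster
   than linearly for [beta < 2], by comparison of [u^(1 - q)] with
   [c s^(1 + gamma) (1 - |x - y|^2 / rho^2)] on interior balls.  The case
   [beta = 2] follows by continuity in [beta]. *)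

Set Implicit Arguments.
Unset Strict Implicit.
Unset Printing Implicit Defensive.

(** * One-variable calculus: first and second order conditions at a maximum *)

Section one_variable.
Context {R : realType}.
Implicit Types (f g : R -> R) (x : R).

Lemma is_derive_first_order f x d : is_derive x 1 f d ->
  forall e, 0 < e -> \forall h \near (0 : R),
    `|f (x + h) - f x - d * h| <= e * `|h|.
Proof.
move=> [fx <-] e e0.
have /eqaddoP /(_ e e0) := derivable_nbhs fx.
apply: filterS => h /=.
rewrite !fctE /= /shift /= [h%:A]mulr1 opprD addrA.
by rewrite [h *: _]mulrC [h + x]addrC.
Qed.

Lemma is_derive_local_lip f x d : is_derive x 1 f d ->
  exists L, 0 < L /\ \forall h \near (0 : R), `|f (x + h) - f x| <= L * `|h|.
Proof.
move=> /is_derive_first_order/(_ 1 ltr01) H.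
exists (1 + `|d|); split; first by rewrite ltr_wpDr.
apply: filterS H => h H.
have -> : f (x + h) - f x = (f (x + h) - f x - d * h) + d * h by rewrite subrK.
by rewrite (le_trans (ler_normD _ _))// mulrDl lerD// -?normrM.
Qed.

(** A negative [d] would push [f (x - h)] above [f x], already with error [- d / 2] in the
    first-order expansion. The one-sided form fits the top time of a cylinder, where only earlier
    times compete. *)
Lemma is_derive_left_max f x d : is_derive x 1 f d ->
  (\forall h \near (0 : R)^'+, f (x - h) <= f x) -> 0 <= d.
Proof.
move=> /is_derive_first_order H fm; rewrite leNgt; apply/negP => d0.
have e0 : 0 < - d / 2 by rewrite divr_gt0 ?oppr_gt0.
have H1 : \forall h \near (0 : R)^'+,
   `|f (x - h) - f x - d * - h| <= - d / 2 * `|- h|.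
  have H2 : (- h @[h --> (0 : R)^'+]) --> (0 : R).
    rewrite -[X in _ --> X]oppr0; apply: cvgN.
    by apply: cvg_at_right_filter; exact: cvg_id.
  exact: (H2 _ (H _ e0)).
near (0 : R)^'+ => h.
have h0 : 0 < h by near: h; exact: nbhs_right_gt.
have h1 : f (x - h) <= f x by near: h.
have : `|f (x - h) - f x - d * - h| <= - d / 2 * `|- h| by near: h.
rewrite normrN (gtr0_norm h0) ler_norml => /andP[+ _].
move: h0 h1 d0; set A := f (x - h); set B := f x.
move=> h0 h1 d0 h2; suff : 0 < - d / 2 * h by lra.
exact: mulr_gt0.
Unshelve. all: by end_near.
Qed.

(** The derivatives are parameters of a relation, so that the sum, product, scaling and power rules
    below compute them. The first derivative must exist near [x], the second only at [x]. *)
Definition twice_diff f x (d1 d2 : R) :=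
  exists2 f1 : R -> R, (\forall y \near x, is_derive (y : R) 1 f (f1 y)) &
    f1 x = d1 /\ is_derive x 1 f1 d2.

Lemma twice_diff_is_derive f x d1 d2 : twice_diff f x d1 d2 -> is_derive x 1 f d1.
Proof. by move=> [f1 /nbhs_singleton H [<- _]]. Qed.

Lemma twice_diff_cst (c x : R) : twice_diff (cst c) x 0 0.
Proof.
exists (cst 0); last by split => //; exact: is_derive_cst.
by near=> y; exact: is_derive_cst.
Unshelve. all: by end_near. Qed.

Lemma twice_diff_id (x : R) : twice_diff id x 1 0.
Proof.
exists (cst 1); last by split => //; exact: is_derive_cst.
by near=> y; exact: is_derive_id.
Unshelve. all: by end_near. Qed.

Lemma twice_diffD f g x d1 d2 e1 e2 : twice_diff f x d1 d2 ->
  twice_diff g x e1 e2 -> twice_diff (fun y => f y + g y) x (d1 + e1) (d2 + e2).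
Proof.
move=> [f1 Hf [<- f2]] [g1 Hg [<- g2]].
exists (fun y => f1 y + g1 y); last by split => //; exact: is_deriveD.
by near=> y; apply: is_deriveD; near: y.
Unshelve. all: by end_near.
Qed.

Lemma twice_diffM f g x d1 d2 e1 e2 : twice_diff f x d1 d2 ->
  twice_diff g x e1 e2 ->
  twice_diff (fun y => f y * g y) x (d1 * g x + f x * e1)
    (d2 * g x + 2 * (d1 * e1) + f x * e2).
Proof.
move=> Tf Tg; have f0 := twice_diff_is_derive Tf; have g0 := twice_diff_is_derive Tg.
case: Tf f0 => [f1 Hf [<- f2]] f0; case: Tg g0 => [g1 Hg [<- g2]] g0.
exists (fun y => f1 y * g y + f y * g1 y); last first.
  split => //.
  have -> : d2 * g x + 2 * (f1 x * g1 x) + f x * e2 =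
     (f1 x *: g1 x + g x *: d2) + (f x *: e2 + g1 x *: f1 x).
    by rewrite /GRing.scale /=; ring.
  by apply: is_deriveD; apply: is_deriveM.
near=> y.
rewrite addrC [f1 y * _]mulrC.
by apply: is_deriveM; near: y.
Unshelve. all: by end_near.
Qed.

Lemma twice_diffZ f x d1 d2 c : twice_diff f x d1 d2 ->
  twice_diff (fun y => c * f y) x (c * d1) (c * d2).
Proof.
move=> /(twice_diffM (twice_diff_cst c x)); rewrite /cst /=.
by rewrite !mul0r mulr0 !add0r.
Qed.

Lemma twice_diff_scale f c d1 d2 : twice_diff f 0 d1 d2 ->
  twice_diff (fun y => f (c * y)) 0 (c * d1) (c ^+ 2 * d2).
Proof.
have cd (y : R) : is_derive y 1 ( *%R c : R -> R) c.
  by rewrite -[X in is_derive _ _ _ X]mulr1; exact: (is_deriveZ (f := id) c).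
move=> [f1 Hf [<- f2]]; exists (fun y => c * f1 (c * y)); last first.
  split; first by rewrite mulr0.
  have -> : c ^+ 2 * d2 = c *: (d2 * c) by rewrite /GRing.scale /=; ring.
  apply: (is_deriveZ (f := f1 \o ( *%R c)) c).
  by apply: is_derive1_comp; rewrite mulr0.
have cc : (c * y @[y --> (0 : R)]) --> (0 : R).
  rewrite -[X in _ --> X](mulr0 c); apply: cvgMr; exact: cvg_id.
have := cc _ Hf; rewrite /= nbhs_filterE /= => H.
apply: filterS H => y /= H; rewrite mulrC.
exact: (is_derive1_comp (f := f) (g := *%R c)).
Qed.

Lemma twice_diff_powR f s x d1 d2 : 0 < f x -> twice_diff f x d1 d2 ->
  twice_diff (fun y => f y `^ s) x (s * f x `^ (s - 1) * d1)
    (s * f x `^ (s - 1) * d2 + s * (s - 1) * f x `^ (s - 2) * d1 ^+ 2).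
Proof.
move=> fx0 Tf; have f0 := twice_diff_is_derive Tf.
case: Tf f0 => [f1 Hf [<- f2]] f0.
have cf : {for x, continuous f}.
  by apply/differentiable_continuous/derivable1_diffP; case: f0.
have pf : \forall y \near x, 0 < f y.
  exact: (cvgr_gt (f x) cf).
have D r y : 0 < f y -> is_derive y 1 f (f1 y) ->
   is_derive y 1 (fun y => f y `^ r) (r * f y `^ (r - 1) * f1 y).
  move=> fy0 Hy.
  exact: is_derive1_comp (is_derive1_powR r fy0) Hy.
exists (fun y => s * f y `^ (s - 1) * f1 y).
  by near=> y; apply: D; near: y.
split => //.
have := is_deriveM (is_deriveZ s (D (s - 1) x fx0 f0)) f2.
rewrite /GRing.scale /=; set A := (X in is_derive _ _ _ X).
suff <- : A = s * f x `^ (s - 1) * d2 + s * (s - 1) * f x `^ (s - 2) * f1 x ^+ 2.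
  by [].
rewrite /A; have -> : s - 2 = s - 1 - 1 by ring.
by rewrite [(s *: _)]/GRing.scale /= /GRing.scale /=; ring.
Unshelve. all: by end_near.
Qed.

(** The first-order part is Fermat's rule. If [d2 > 0], then [f1 c >= d2 c / 2 > 0] for small
    [c > 0], and the mean value theorem on [[0, e / 2]] puts [f (e / 2)] above [f 0]. *)
Lemma twice_diff_max f d1 d2 : twice_diff f 0 d1 d2 ->
  (\forall h \near (0 : R), f h <= f 0) -> d1 = 0 /\ d2 <= 0.
Proof.
move=> Tf fm; have f0 := twice_diff_is_derive Tf.
have d10 : d1 = 0.
  have [e /= e0 He] : exists2 e : R, 0 < e & forall h, `|h| < e ->
      f h <= f 0 /\ derivable f h 1.
    case: Tf => f1 Hf _.
    have H : \forall h \near (0 : R), f h <= f 0 /\ derivable f h 1.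
      by near=> h; split; [|apply: (@ex_derive _ _ _ h 1 f (f1 h))]; near: h.
    move: H => /nbhs_ballP[e /= e0 H]; exists e => // h he.
    by apply: H; rewrite /ball /= sub0r normrN.
  have := @derive1_at_max _ f (- e) e 0 _ _ _ _.
  move=> H; have {}H : is_derive (0 : R) 1 f 0.
    apply: H.
    - by rewrite (le_trans _ (ltW e0))// oppr_le0 ltW.
    - by move=> t; rewrite in_itv /= -ltr_norml => /He[].
    - by rewrite in_itv /= oppr_lt0 e0.
    - by move=> t; rewrite in_itv /= -ltr_norml => /He[].
  by case: H => _ <-; case: f0.
split => //; subst d1; case: Tf => f1 Hf [f10 f2].
rewrite leNgt; apply/negP => d20.
have e0 : 0 < d2 / 2 by rewrite divr_gt0.
have /is_derive_first_order/(_ _ e0) := f2 => H.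
have [e /= {}e0 He] : exists2 e : R, 0 < e & forall h : R, `|h| < e ->
    [/\ is_derive h 1 f (f1 h), f h <= f 0 & `|f1 (0 + h) - f1 0 - d2 * h| <= d2 / 2 * `|h|].
  have : \forall h \near (0 : R), [/\ is_derive (h : R) 1 f (f1 h),
      f h <= f 0 & `|f1 (0 + h) - f1 0 - d2 * h| <= d2 / 2 * `|h|].
    by near=> h; split; near: h.
  move=> /nbhs_ballP[e /= r0 H']; exists e => // h he.
  by apply: H'; rewrite /ball /= sub0r normrN.
have e20 : 0 < e / 2 by rewrite divr_gt0.
have e2e : e / 2 < e by lra.
have nr (h : R) : h \in `[0, e / 2] -> `|h| < e.
  by rewrite in_itv /= => /andP[h0 h1]; rewrite ger0_norm//; lra.
have [||c ce] := @MVT _ f f1 0 (e / 2) e20.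
- move=> x xe; have [] := He x _ => //; apply: nr; exact: subset_itv_oo_cc xe.
- by apply: derivable_within_continuous => x /nr /He[[]].
move=> E; have := nr _ (subset_itv_oo_cc ce).
move=> /He[_ _]; rewrite add0r f10 subr0.
have : f (e / 2) <= f 0 by have [] := He (e / 2) _ => //; rewrite gtr0_norm.
move: ce; rewrite in_itv /= => /andP[c0 _] fe.
rewrite (gtr0_norm c0) ler_norml => /andP[H1 _].
have : f1 c * (e / 2 - 0) <= 0 by rewrite -E subr_le0.
rewrite subr0 pmulr_lle0// => f1c.
suff : 0 < d2 / 2 * c by lra.
by apply: mulr_gt0 => //; lra.
Unshelve. all: by end_near.
Qed.

End one_variable.

(** * Inequalities for powers, and the contradiction at a positive maximum *)

Section inequalities.
Context {R : realType}.
Implicit Types a b l s t v w x y z : R.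

(** [ln] lies below its tangent at the weighted arithmetic mean [M]; averaging the tangent bounds at
    [x], [y] and [z] gives exactly [ln M]. *)
Lemma powR_AMGM3 w1 w2 w3 x y z : 0 <= w1 -> 0 <= w2 -> 0 <= w3 ->
  w1 + w2 + w3 = 1 -> 0 < x -> 0 < y -> 0 < z ->
  x `^ w1 * y `^ w2 * z `^ w3 <= w1 * x + w2 * y + w3 * z.
Proof.
move=> w10 w20 w30 w1E x0 y0 z0.
set M := _ + w3 * z.
have M0 : 0 < M.
  rewrite lt_neqAle eq_sym !addr_ge0 ?mulr_ge0 ?(ltW x0) ?(ltW y0) ?(ltW z0)// andbT.
  apply/eqP; rewrite /M => M0.
  have A1 : 0 <= w1 * x by rewrite mulr_ge0// ltW.
  have A2 : 0 <= w2 * y by rewrite mulr_ge0// ltW.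
  have A3 : 0 <= w3 * z by rewrite mulr_ge0// ltW.
  have /eqP : w1 * x = 0 by lra.
  rewrite mulf_eq0 (gt_eqF x0) orbF => /eqP E1.
  have /eqP : w2 * y = 0 by lra.
  rewrite mulf_eq0 (gt_eqF y0) orbF => /eqP E2.
  have /eqP : w3 * z = 0 by lra.
  rewrite mulf_eq0 (gt_eqF z0) orbF => /eqP E3.
  by move: w1E; rewrite E1 E2 E3 !addr0 => /eqP; rewrite eq_sym oner_eq0.
have lnM c : 0 < c -> ln c <= ln M + (c / M - 1).
  move=> c0; have cM : 0 < c / M by rewrite divr_gt0.
  have -> : ln c = ln M + ln (c / M).
    by rewrite -lnM ?posrE// mulrC divfK// gt_eqF.
  by rewrite lerD2l -(addrK 1 (ln _)) lerD2r -{2}(lnK cM) addrC; exact: expR_ge1Dx.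
have -> : x `^ w1 * y `^ w2 * z `^ w3 = expR (w1 * ln x + w2 * ln y + w3 * ln z).
  by rewrite /powR !gt_eqF// !expRD.
rewrite -[leRHS](lnK (_ : M \in Num.pos)) ?posrE// ler_expR.
have -> : ln M = w1 * (ln M + (x / M - 1)) + w2 * (ln M + (y / M - 1))
               + w3 * (ln M + (z / M - 1)).
  have : w1 * (x / M) + w2 * (y / M) + w3 * (z / M) = 1.
    by rewrite !mulrA -!mulrDl -/M divff// gt_eqF.
  move: (ln M) (x / M) (y / M) (z / M) => m X Y Z E.
  have -> : w1 * (m + (X - 1)) + w2 * (m + (Y - 1)) + w3 * (m + (Z - 1)) =
    (w1 + w2 + w3) * m + (w1 * X + w2 * Y + w3 * Z) - (w1 + w2 + w3) by ring.
  by rewrite E w1E; ring.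
by rewrite !lerD// ler_wpM2l// lnM.
Qed.

(** Dividing every entry by its mixture [X], [Y] or [Z] factors the right-hand side out of both
    products. The normalised products are bounded by [powR_AMGM3], and these bounds average to
    [w1 + w2 + w3 = 1]. *)
Lemma powR3_concave w1 w2 w3 l x y z x' y' z' :
  0 <= w1 -> 0 <= w2 -> 0 <= w3 -> w1 + w2 + w3 = 1 -> 0 < l < 1 ->
  0 < x -> 0 < y -> 0 < z -> 0 < x' -> 0 < y' -> 0 < z' ->
  l * (x `^ w1 * y `^ w2 * z `^ w3) + (1 - l) * (x' `^ w1 * y' `^ w2 * z' `^ w3)
  <= (l * x + (1 - l) * x') `^ w1 * (l * y + (1 - l) * y') `^ w2 *
     (l * z + (1 - l) * z') `^ w3.
Proof.
move=> w10 w20 w30 wE /andP[l0 l1] x0 y0 z0 x'0 y'0 z'0.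
have l'0 : 0 < 1 - l by rewrite subr_gt0.
set X := l * x + _; set Y := l * y + _; set Z := l * z + _.
have X0 : 0 < X by rewrite addr_gt0 ?mulr_gt0.
have Y0 : 0 < Y by rewrite addr_gt0 ?mulr_gt0.
have Z0 : 0 < Z by rewrite addr_gt0 ?mulr_gt0.
have split3 (p r s : R) : 0 < p -> 0 < r -> 0 < s ->
    p `^ w1 * r `^ w2 * s `^ w3 =
    X `^ w1 * Y `^ w2 * Z `^ w3 * ((p / X) `^ w1 * (r / Y) `^ w2 * (s / Z) `^ w3).
  move=> p0 r0 s0.
  have E (c d w : R) : 0 < c -> 0 < d -> c `^ w = d `^ w * (c / d) `^ w.
    move=> c0 d0; rewrite -powRM ?ltW ?divr_gt0//.
    by rewrite mulrC divfK// gt_eqF.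
  by rewrite (E p X)// (E r Y)// (E s Z)//; ring.
rewrite (split3 x y z)// (split3 x' y' z')//.
rewrite mulrCA [X in _ + X]mulrCA -mulrDr ger_pMr; last first.
  by rewrite !mulr_gt0// powR_gt0.
have xX : 0 < x / X by exact: divr_gt0.
have yY : 0 < y / Y by exact: divr_gt0.
have zZ : 0 < z / Z by exact: divr_gt0.
have xX' : 0 < x' / X by exact: divr_gt0.
have yY' : 0 < y' / Y by exact: divr_gt0.
have zZ' : 0 < z' / Z by exact: divr_gt0.
have H1 := powR_AMGM3 w10 w20 w30 wE xX yY zZ.
have H2 := powR_AMGM3 w10 w20 w30 wE xX' yY' zZ'.
apply: le_trans (lerD (ler_wpM2l (ltW l0) H1) (ler_wpM2l (ltW l'0) H2)) _.
have EX : l * (x / X) + (1 - l) * (x' / X) = 1 by rewrite !mulrA -mulrDl divff// gt_eqF.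
have EY : l * (y / Y) + (1 - l) * (y' / Y) = 1 by rewrite !mulrA -mulrDl divff// gt_eqF.
have EZ : l * (z / Z) + (1 - l) * (z' / Z) = 1 by rewrite !mulrA -mulrDl divff// gt_eqF.
set lhs := (X in X <= 1).
have -> : lhs = w1 * (l * (x / X) + (1 - l) * (x' / X)) +
   w2 * (l * (y / Y) + (1 - l) * (y' / Y)) + w3 * (l * (z / Z) + (1 - l) * (z' / Z)).
  by rewrite /lhs; ring.
by rewrite EX EY EZ !mulr1 wE.
Qed.

(* Cauchy-Schwarz reduces this to the concavity of [t `^ (b - 1)]. *)
Lemma sqr_powR_convex b l t t' v v' : 1 <= b <= 2 -> 0 < l < 1 ->
  0 < t -> 0 < t' ->
  (l * v + (1 - l) * v') ^+ 2 * (l * t + (1 - l) * t') `^ (1 - b)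
  <= l * (v ^+ 2 * t `^ (1 - b)) + (1 - l) * (v' ^+ 2 * t' `^ (1 - b)).
Proof.
move=> /andP[b1 b2] /andP[l0 l1] t0 t'0.
have l'0 : 0 < 1 - l by rewrite subr_gt0.
have T0 : 0 < l * t + (1 - l) * t' by rewrite addr_gt0 ?mulr_gt0.
(* Concavity of [t^(b - 1)] is the three-factor inequality with a single varying factor; the padding
   weight [2 - b] is where [b <= 2] enters. *)
have := @powR3_concave 0 (b - 1) (2 - b) l 1 t 1 1 t' 1.
rewrite !powR1 !powRr0 !mulr1 !mul1r subrKC !powR1 !mulr1 => H.
have {}H : l * t `^ (b - 1) + (1 - l) * t' `^ (b - 1) <= (l * t + (1 - l) * t') `^ (b - 1).
  by apply: H => //; rewrite ?subr_ge0 ?l0 ?l1//; ring.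
have -> : 1 - b = - (b - 1) by ring.
rewrite !powRN.
have s0 : 0 < t `^ (b - 1) by exact: powR_gt0.
have s'0 : 0 < t' `^ (b - 1) by exact: powR_gt0.
move: H s0 s'0; set s := t `^ _; set s' := t' `^ _ => H s0 s'0.
have m0 : 0 < l * s + (1 - l) * s' by rewrite addr_gt0 ?mulr_gt0.
apply: (@le_trans _ _ ((l * v + (1 - l) * v') ^+ 2 / (l * s + (1 - l) * s'))).
  by rewrite ler_wpM2l ?sqr_ge0// lef_pV2 ?posrE ?powR_gt0.
rewrite ler_pdivrMr// -subr_ge0.
have -> : (l * (v ^+ 2 / s) + (1 - l) * (v' ^+ 2 / s')) * (l * s + (1 - l) * s') -
  (l * v + (1 - l) * v') ^+ 2 = l * (1 - l) * (v * s' - v' * s) ^+ 2 / (s * s').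
  by field; rewrite !gt_eqF.
have l0' := ltW l0; have l'0' := ltW l'0; have ss := ltW (mulr_gt0 s0 s'0).
by apply: divr_ge0 => //; apply: mulr_ge0; [exact: mulr_ge0|exact: sqr_ge0].
Qed.

(* Testing the second-order condition with step lengths proportional to the
   values [v1], [v3] and their mean makes the gradient terms cancel. *)
Lemma concavity_max_contradiction alpha b g w l P
    (v1 v2 v3 t1 t3 a1 a2 a3 T1 T2 T3 L1 L2 L3 : R) :
  let m := l * v1 + (1 - l) * v3 in let t2 := l * t1 + (1 - l) * t3 in
  let rhs v t a T := (alpha^-1 - 1) * P / v
    + alpha * a * t `^ g * v `^ (- (1 + g + w)) - b^-1 * t `^ (1 - b) * T in
  0 < alpha <= 1 -> 1 <= b <= 2 -> 0 <= g -> 0 <= w -> 0 < l < 1 -> 0 <= P ->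
  0 < v1 -> 0 < v2 -> 0 < v3 -> 0 < t1 -> 0 < t3 -> 0 < a2 ->
  0 <= T2 -> T2 <= T1 -> T2 <= T3 ->
  - L1 = rhs v1 t1 a1 T1 -> - L2 = rhs v2 t2 a2 T2 -> - L3 = rhs v3 t3 a3 T3 ->
  l * (a1 * t1 `^ g * v1 `^ (1 - g - w)) + (1 - l) * (a3 * t3 `^ g * v3 `^ (1 - g - w))
    <= a2 * t2 `^ g * m `^ (1 - g - w) ->
  l * (v1 ^+ 2 * L1) + (1 - l) * (v3 ^+ 2 * L3) - m ^+ 2 * L2 <= 0 ->
  m <= v2.
Proof.
move=> m t2 rhs /andP[al0 al1] bb g0 w0 ll P0 v10 v20 v30 t10 t30 a20.
move=> T20 T12 T32 E1 E2 E3 Ha H2; rewrite leNgt; apply/negP => mv.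
have [l0 l1] := andP ll; have [b1 b2] := andP bb.
have l'0 : 0 < 1 - l by rewrite subr_gt0.
have b0 : 0 < b by apply: lt_le_trans b1.
have ib0 : 0 < b^-1 by rewrite invr_gt0.
have m0 : 0 < m by rewrite addr_gt0 ?mulr_gt0.
have t20 : 0 < t2 by rewrite addr_gt0 ?mulr_gt0.
have Hv := sqr_powR_convex v1 v3 bb ll t10 t30; rewrite -/m -/t2 in Hv.
(* Multiplying an equation by a squared step length turns the source exponent into the one of the
   concavity hypothesis [Ha]. *)
have sq v : 0 < v -> v ^+ 2 * v `^ (- (1 + g + w)) = v `^ (1 - g - w).
  move=> v0; rewrite -powR_mulrn ?(ltW v0)// -powRD; last first.
    by rewrite (gt_eqF v0); apply/implyP.
  by congr (_ `^ _); ring.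
have K0 : 0 <= (alpha^-1 - 1) * P by rewrite mulr_ge0// subr_ge0 invf_ge1.
set K := (_ - 1) * P in K0.
have mul v t a T L : 0 < v -> - L = rhs v t a T ->
   v ^+ 2 * L = b^-1 * (v ^+ 2 * t `^ (1 - b)) * T - K * v
     - alpha * (a * t `^ g * v `^ (1 - g - w)).
  move=> v0 /(canRL (@opprK _)) ->; rewrite -sq//; rewrite /rhs -/K; field.
  by rewrite !gt_eqF.
have M1 := mul _ _ _ _ _ v10 E1; have M3 := mul _ _ _ _ _ v30 E3.
have mono v t T : 0 < v -> 0 < t -> T2 <= T ->
    b^-1 * (v ^+ 2 * t `^ (1 - b)) * T2 <= b^-1 * (v ^+ 2 * t `^ (1 - b)) * T.
  move=> v0 t0 TT; rewrite ler_wpM2l//.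
  by rewrite mulr_ge0 ?(ltW ib0)// mulr_ge0 ?powR_ge0// sqr_ge0.
have N1 := mono _ _ _ v10 t10 T12; have N3 := mono _ _ _ v30 t30 T32.
(* In the middle the multiplier is [m ^+ 2], but the equation contains [v2]. Since [v2 < m],
   replacing [v2] by [m] lowers the gradient and source terms, strictly for the source, whose
   exponent [- (1 + g + w)] is negative. *)
have key : - (m ^+ 2 * L2) > K * m + alpha * (a2 * t2 `^ g * m `^ (1 - g - w))
    - b^-1 * (m ^+ 2 * t2 `^ (1 - b)) * T2.
  have -> : - (m ^+ 2 * L2) = m ^+ 2 * - L2 by rewrite mulrN.
  rewrite E2 /rhs -/K.
  have A1 : K * m <= m ^+ 2 * (K / v2).
    have -> : m ^+ 2 * (K / v2) = K * m * (m / v2) by ring.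
    apply: ler_peMr; first by rewrite mulr_ge0 ?(ltW m0).
    by rewrite ler_pdivlMr// mul1r ltW.
  have A2 : alpha * (a2 * t2 `^ g * m `^ (1 - g - w)) <
     m ^+ 2 * (alpha * a2 * t2 `^ g * v2 `^ (- (1 + g + w))).
    rewrite -sq//.
    have -> : alpha * (a2 * t2 `^ g * (m ^+ 2 * m `^ (- (1 + g + w)))) =
       m ^+ 2 * (alpha * a2 * t2 `^ g * m `^ (- (1 + g + w))) by ring.
    rewrite ltr_pM2l ?exprn_gt0// ltr_pM2l ?mulr_gt0 ?powR_gt0//.
    rewrite !powRN ltf_pV2 ?posrE ?powR_gt0//.
    by rewrite gt0_ltr_powR ?nnegrE ?(ltW v20) ?(ltW m0)//; lra.
  have -> : m ^+ 2 * (K / v2 + alpha * a2 * t2 `^ g * v2 `^ (- (1 + g + w)) -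
      b^-1 * t2 `^ (1 - b) * T2) = m ^+ 2 * (K / v2) +
      m ^+ 2 * (alpha * a2 * t2 `^ g * v2 `^ (- (1 + g + w))) -
      b^-1 * (m ^+ 2 * t2 `^ (1 - b)) * T2 by ring.
  lra.
(* With the smallest time derivative [T2] in all three places, [sqr_powR_convex] compares the time
   terms, as [T2 >= 0]. *)
have Hv' : b^-1 * (m ^+ 2 * t2 `^ (1 - b)) * T2 <=
   l * (b^-1 * (v1 ^+ 2 * t1 `^ (1 - b)) * T2) + (1 - l) * (b^-1 * (v3 ^+ 2 * t3 `^ (1 - b)) * T2).
  have -> : l * (b^-1 * (v1 ^+ 2 * t1 `^ (1 - b)) * T2) + (1 - l) * (b^-1 * (v3 ^+ 2 * t3 `^ (1 - b)) * T2)
   = b^-1 * (l * (v1 ^+ 2 * t1 `^ (1 - b)) + (1 - l) * (v3 ^+ 2 * t3 `^ (1 - b))) * T2 by ring.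
  by rewrite ler_wpM2r// ler_wpM2l// ltW.
have N1' := ler_wpM2l (ltW l0) N1; have N3' := ler_wpM2l (ltW l'0) N3.
have Ha' := ler_wpM2l (ltW al0) Ha.
have F1 : l * (v1 ^+ 2 * L1) = l * (b^-1 * (v1 ^+ 2 * t1 `^ (1 - b)) * T1) - K * (l * v1) -
   alpha * (l * (a1 * t1 `^ g * v1 `^ (1 - g - w))) by rewrite M1; ring.
have F3 : (1 - l) * (v3 ^+ 2 * L3) = (1 - l) * (b^-1 * (v3 ^+ 2 * t3 `^ (1 - b)) * T3) - K * ((1 - l) * v3) -
   alpha * ((1 - l) * (a3 * t3 `^ g * v3 `^ (1 - g - w))) by rewrite M3; ring.
have Fm : K * m = K * (l * v1) + K * ((1 - l) * v3) by rewrite /m; ring.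
rewrite mulrDr in Ha'; rewrite Fm in key; rewrite F1 F3 in H2.
lra.
Qed.

End inequalities.

(** * Euclidean balls, tangent spheres and convex sets *)

Section geometry.
Context {R : realType} {n : nat}.
Implicit Types (x y z : 'rV[R]_n) (Omega : set 'rV[R]_n).

Definition sqnorm x : R := \sum_(i < n) x ord0 i ^+ 2.

Lemma sqnorm_ge0 x : 0 <= sqnorm x.
Proof. by apply: sumr_ge0 => i _; exact: sqr_ge0. Qed.

Lemma eucl_ballE y r x : 0 < r -> eucl_ball y r x <-> sqnorm (x - y) < r ^+ 2.
Proof.
move=> r0; rewrite /eucl_ball /eucl_norm /= -/(sqnorm _).
by rewrite -(ltr_sqr (sqrtr_ge0 _) (ltW r0)) sqr_sqrtr// sqnorm_ge0.
Qed.

Lemma sqnorm_continuous y : continuous (fun x => sqnorm (x - y)).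
Proof.
apply: continuous_big => [|i _ x]; first exact: add_continuous.
have c : (z - y) ord0 i @[z --> x] --> (x - y) ord0 i.
  have -> : (fun z : 'rV[R]_n => (z - y) ord0 i) = (fun z => z ord0 i - y ord0 i).
    by apply/funext => z; rewrite !mxE.
  have -> : (x - y) ord0 i = x ord0 i - y ord0 i by rewrite !mxE.
  apply: (cvgB (F := nbhs x)); last exact: cvg_cst.
  exact: coord_continuous.
under eq_fun do rewrite expr2.
by apply: (cvgM (F := nbhs x)).
Qed.

Lemma boundary_eucl_ball y r x : 0 < r -> boundary (eucl_ball y r) x ->
  sqnorm (x - y) = r ^+ 2.
Proof.
move=> r0 [cx nx]; apply/eqP; rewrite eq_le; apply/andP; split; rewrite leNgt; apply/negP => h.
  have : \forall z \near x, r ^+ 2 < sqnorm (z - y).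
    exact: (cvgr_gt _ (@sqnorm_continuous y x)).
  by move=> /cx[z [/eucl_ballE-/(_ r0)/ltW]]; rewrite leNgt => /negP.
apply: nx; have : \forall z \near x, sqnorm (z - y) < r ^+ 2.
  exact: (cvgr_lt _ (@sqnorm_continuous y x)).
by apply: filterS => z /eucl_ballE; exact.
Qed.

(** The sup norm is at most the Euclidean one, so a Euclidean ball lies in the library ball of the
    same radius. *)
Lemma open_eucl_ball Omega x : open Omega -> Omega x ->
  exists2 r, 0 < r & eucl_ball x r `<=` Omega.
Proof.
move=> oO Ox; have /nbhs_ballP[r /= r0 rO] : nbhs x Omega.
  by apply: open_nbhs_nbhs.
exists r => // z /eucl_ballE-/(_ r0) zr; apply: rO.
rewrite mx_norm_ball /ball_ /= [X in X < _]mx_normrE.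
apply/bigmax_ltP; split => // -[i j] _ /=; rewrite ord1.
rewrite -(ltr_sqr (normr_ge0 _) (ltW r0)) real_normK ?num_real//.
apply: le_lt_trans zr; rewrite /sqnorm (bigD1 j)//= -[leLHS]addr0 lerD//.
  by rewrite !mxE -sqrrN opprB.
by apply: sumr_ge0 => k _; exact: sqr_ge0.
Qed.

Lemma sqnorm_shift z k (h : R) :
  sqnorm (h *: delta_mx ord0 k - z) = sqnorm z - 2 * h * z ord0 k + h ^+ 2.
Proof.
rewrite /sqnorm (bigD1 k)//= [in RHS](bigD1 k)//= !mxE !eqxx mulr1.
have -> : \sum_(i < n | i != k) (h *: delta_mx ord0 k - z) ord0 i ^+ 2 =
          \sum_(i < n | i != k) z ord0 i ^+ 2.
  by apply: eq_bigr => i /negbTE ik; rewrite !mxE ik andbF mulr0 sub0r sqrrN.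
ring.
Qed.

Lemma sqnormZ (c : R) x : sqnorm (c *: x) = c ^+ 2 * sqnorm x.
Proof. by rewrite /sqnorm mulr_sumr; apply: eq_bigr => i _; rewrite !mxE exprMn. Qed.

(* The point [x] is approached along a coordinate axis, chosen transversal to
   the sphere, so that only partial derivatives are ever needed. *)
Lemma tangent_balls Omega x : interior_sphere Omega -> boundary Omega x ->
  exists r c, exists e : R, exists k : 'I_n, [/\ 0 < r, 0 < c &
    forall rho, 0 < rho -> rho <= r -> exists y, eucl_ball y rho `<=` Omega /\
      forall h, sqnorm (x + (h * e) *: delta_mx ord0 k - y) =
        rho ^+ 2 - 2 * h * rho * c + h ^+ 2].
Proof.
move=> Osph /Osph[y [r [_ r0 rO /boundary_eucl_ball-/(_ r0) xr]]].
pose nu := y - x.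
have nur : sqnorm nu = r ^+ 2.
  by rewrite -xr -opprB -scaleN1r sqnormZ sqrrN expr1n mul1r.
have [k nuk] : exists k, nu ord0 k != 0.
  apply/existsP; rewrite -negb_forall; apply/negP => /forallP nu0.
  have : sqnorm nu = 0 by apply: big1 => i _; move/eqP: (nu0 i) => ->; rewrite expr0n.
  by rewrite nur => /eqP; rewrite sqrf_eq0 gt_eqF.
(* The sign makes the displacement [h * e] along axis [k] point inwards for [h > 0]; [c] is the
   cosine of its angle with the inner normal [nu]. *)
exists r, (`|nu ord0 k| / r), (Num.sg (nu ord0 k)), k; split => //.
  by rewrite divr_gt0// normr_gt0.
(* The centre lies on the segment from [x] to [y], so the smaller ball touches the large one from
   inside at [x]. *)
move=> rho rho0 rhor; exists (x + (rho / r) *: nu); split.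
  move=> z /eucl_ballE-/(_ rho0) zr; apply: rO; apply/(eucl_ballE _ _ r0).
  have -> : z - y = (z - x) - nu by rewrite /nu opprB addrA subrK.
  move: zr; rewrite opprD addrA.
  have E (c : R) : sqnorm (z - x - c *: nu) = sqnorm (z - x)
      - 2 * c * (\sum_(i < n) (z - x) ord0 i * nu ord0 i) + c ^+ 2 * r ^+ 2.
    rewrite -nur /sqnorm !mulr_sumr -sumrB -big_split /=.
    by apply: eq_bigr => i _; rewrite !mxE; ring.
  have E1 := E 1; rewrite scale1r in E1; rewrite E E1.
  (* With [S] the inner product of [z - x] and [nu], and [c = rho / r], membership in the small ball
     reads [Q < 2 c S]. This forces [S > 0], so the condition survives raising [c] to 1. *)
  set S := \sum_(i < n) _; move: (sqnorm_ge0 (z - x)); set Q := sqnorm _ => Q0.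
  have -> : (rho / r) ^+ 2 * r ^+ 2 = rho ^+ 2 by field; rewrite gt_eqF.
  rewrite expr1n mul1r.
  have c0 : 0 < rho / r by rewrite divr_gt0.
  have c1 : rho / r <= 1 by rewrite ler_pdivrMr// mul1r.
  move: c0 c1; set c := rho / r => c0 c1 H1.
  have S0 : 0 < S.
    rewrite ltNge; apply/negP => S0.
    have : c * S <= 0 by rewrite mulr_ge0_le0// ltW.
    by lra.
  have : c * S <= S by rewrite ler_piMl// ltW.
  by lra.
move=> h; rewrite opprD addrACA subrr add0r sqnorm_shift (sqnormZ (rho / r)) nur [(_ *: nu) _ _]mxE.
rewrite [(h * _) ^+ 2]exprMn sqr_sg nuk mulr1 [in RHS]normrEsg.
by field; rewrite gt_eqF.
Qed.

Lemma convex_setP Omega :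
  convex_set (Omega : set (convex_lmodType 'rV[R]_n)) ->
  forall l x y, 0 <= l <= 1 -> Omega x -> Omega y -> Omega (l *: x + (1 - l) *: y).
Proof.
move=> cO l x y l01 Ox Oy.
have := cO x y (Itv01 (andP l01).1 (andP l01).2).
by rewrite !inE => /(_ Ox Oy).
Qed.

Lemma closure_convex Omega :
  convex_set (Omega : set (convex_lmodType 'rV[R]_n)) ->
  forall l x y, 0 <= l <= 1 -> closure Omega x -> closure Omega y ->
  closure Omega (l *: x + (1 - l) *: y).
Proof.
move=> /convex_setP cO l x y l01 cx cy B.
have c : {for (x, y), continuous (fun p : 'rV[R]_n * 'rV[R]_n => l *: p.1 + (1 - l) *: p.2)}.
  apply: cvgD; apply: cvgZr; [exact: cvg_fst|exact: cvg_snd].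
move=> /c [[P Q] /= [Px Qy] PQ].
have [x' [Ox' Px']] := cx _ Px; have [y' [Oy' Qy']] := cy _ Qy.
exists (l *: x' + (1 - l) *: y'); split; first exact: cO.
exact: (PQ (x', y')).
Qed.

(** [f z] is the point whose mixture with [z] is the given one. As [f y = x] lies in the open
    [Omega], so does [f z] for some [z] of [Omega] close to [y], and convexity applies to [f z] and
    [z]. *)
Lemma open_convex_mix Omega : open Omega ->
  convex_set (Omega : set (convex_lmodType 'rV[R]_n)) ->
  forall l x y, 0 < l < 1 -> Omega x -> closure Omega y ->
  Omega (l *: x + (1 - l) *: y).
Proof.
move=> oO /convex_setP cO l x y /andP[l0 l1] Ox cy.
pose f z := l^-1 *: (l *: x + (1 - l) *: y - (1 - l) *: z).
have fy : f y = x by rewrite /f addrK scalerA mulVf ?gt_eqF// scale1r.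
have c : {for y, continuous f}.
  apply: (cvgZr (F := nbhs y)); apply: (cvgB (F := nbhs y)); first exact: cvg_cst.
  by apply: (cvgZr (F := nbhs y)); exact: cvg_id.
have : nbhs y (f @^-1` Omega) by apply: (c Omega); rewrite fy; exact: open_nbhs_nbhs.
move=> /cy[z [Oz Ofz]].
have -> : l *: x + (1 - l) *: y = l *: f z + (1 - l) *: z.
  by rewrite /f scalerA divff ?gt_eqF// scale1r subrK.
by apply: cO => //; rewrite !ltW.
Qed.

Lemma compact_closure Omega : bounded_set Omega -> compact (closure Omega).
Proof.
move=> [M [Mr HM]].
pose D := [set x : 'rV[R]_n | `|x| <= M + 1].
have cD : closed D.
  apply: (@closed_comp _ _ (fun x : 'rV[R]_n => `|x|) [set r : R | r <= M + 1]).
    by move=> x _; exact: norm_continuous.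
  exact: closed_le.
have OD : Omega `<=` D by move=> x Ox; apply: HM => //; rewrite ltrDl.
apply: (subclosed_compact (@closed_closure _ _) (B := D)).
  apply: bounded_closed_compact => //.
  exists (M + 1); split; first exact: num_real.
  move=> N MN x /= /le_trans; apply; exact: ltW.
by rewrite closureE; exact: smallest_sub.
Qed.

End geometry.

(** * Continuity relative to a subset *)

Section continuity.

Lemma within_continuous_comp_in {T S U : topologicalType} (K : set T) (A : set S)
    (phi : T -> S) (f : S -> U) :
  {within A, continuous f} -> {within K, continuous phi} ->
  (forall x, K x -> A (phi x)) -> {within K, continuous (fun x => f (phi x))}.
Proof.
rewrite !subspace_continuousP => cf cphi KA x Kx B /(cf _ (KA _ Kx)) H.
have := cphi x Kx _ H; rewrite !nbhs_simpl /within /= => H'.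
by apply: filterS H' => z H' Kz; apply: H' => //; exact: KA.
Qed.

Lemma within_continuousM {T : topologicalType} {R : realType} (K : set T)
    (f g : T -> R) : {within K, continuous f} -> {within K, continuous g} ->
  {within K, continuous (fun x => f x * g x)}.
Proof. by rewrite !subspace_continuousP => cf cg x Kx; apply: cvgM; [exact: cf|exact: cg]. Qed.

Lemma within_continuousN {T : topologicalType} {R : realType} (K : set T)
    (f : T -> R) : {within K, continuous f} ->
  {within K, continuous (fun x => - f x)}.
Proof. by rewrite !subspace_continuousP => cf x Kx; apply: cvgN; exact: cf. Qed.

Lemma powR_continuous_at {R : realType} (a x : R) : 0 < x ->
  {for x, continuous (fun y => y `^ a)}.
Proof.
move=> x0; apply/differentiable_continuous/derivable1_diffP.
by have [] := is_derive1_powR a x0.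
Qed.

(** Differentiability settles [x > 0]; at 0 the radius [e^(1 / a)] works explicitly. *)
Lemma powR_within_continuous {R : realType} (a : R) : 0 < a ->
  {within [set x : R | 0 <= x], continuous (fun x => x `^ a)}.
Proof.
move=> a0; apply/subspace_continuousP => x /=; rewrite le_eqVlt => /predU1P[<-|x0].
  apply/cvgrPdist_lt => e e0; rewrite /within /=.
  have d0 : 0 < e `^ a^-1 by exact: powR_gt0.
  apply/nbhs_ballP; exists (e `^ a^-1) => // y.
  rewrite /ball /= sub0r normrN => yd y0.
  rewrite /from_subspace powR0 ?gt_eqF// sub0r normrN ger0_norm ?powR_ge0//.
  rewrite ger0_norm// in yd.
  have -> : e = (e `^ a^-1) `^ a by rewrite -powRrM mulVf ?gt_eqF// powRr1// ltW.
  by rewrite gt0_ltr_powR// nnegrE ltW.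
by apply: cvg_within_filter; exact: powR_continuous_at.
Qed.

Lemma within_continuous_powR {T : topologicalType} {R : realType} (K : set T)
    (f : T -> R) (a : R) : 0 < a -> {within K, continuous f} ->
  (forall x, K x -> 0 <= f x) -> {within K, continuous (fun x => f x `^ a)}.
Proof.
move=> a0 cf f0.
exact: (@within_continuous_comp_in _ _ _ K _ f (fun r => r `^ a) (powR_within_continuous a0) cf f0).
Qed.

Lemma mix_continuous {R : realType} {n : nat} (b c : R) :
  continuous (fun p : ('rV[R]_n * R) * ('rV[R]_n * R) =>
    (b *: p.1.1 + c *: p.2.1, b * p.1.2 + c * p.2.2)).
Proof.
move=> p.
have c11 : continuous (fun p : ('rV[R]_n * R) * ('rV[R]_n * R) => p.1.1).
  by move=> q; apply: (@continuous_comp _ _ _ fst fst q); exact: cvg_fst.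
have c12 : continuous (fun p : ('rV[R]_n * R) * ('rV[R]_n * R) => p.1.2).
  by move=> q; apply: (@continuous_comp _ _ _ fst snd q); [exact: cvg_fst|exact: cvg_snd].
have c21 : continuous (fun p : ('rV[R]_n * R) * ('rV[R]_n * R) => p.2.1).
  by move=> q; apply: (@continuous_comp _ _ _ snd fst q); [exact: cvg_snd|exact: cvg_fst].
have c22 : continuous (fun p : ('rV[R]_n * R) * ('rV[R]_n * R) => p.2.2).
  by move=> q; apply: (@continuous_comp _ _ _ snd snd q); exact: cvg_snd.
apply: (cvg_pair (F := nbhs p) (G := nbhs (b *: p.1.1 + c *: p.2.1))
  (H := nbhs (b * p.1.2 + c * p.2.2))).
  apply: (cvgD (F := nbhs p)); apply: (cvgZr (F := nbhs p)); [exact: c11|exact: c21].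
apply: (cvgD (F := nbhs p)); apply: (cvgMr (F := nbhs p)); [exact: c12|exact: c22].
Qed.

End continuity.

(** * Restriction to coordinate lines *)

Section line.
Context {R : realType} {n : nat}.
Implicit Types (x : 'rV[R]_n) (Omega : set 'rV[R]_n) (f : 'rV[R]_n -> R).

Definition along (k : 'I_n) f x : R -> R := fun h => f (x + h *: delta_mx ord0 k).

Lemma along_is_derive k f x (h : R) :
  has_partial k f (x + h *: delta_mx ord0 k) ->
  is_derive h 1 (along k f x) (partial k f (x + h *: delta_mx ord0 k)).
Proof.
have E : (fun r : R => r^-1 *: ((along k f x \o shift h) (r *: 1) - along k f x h)) =
  (fun r : R => r^-1 *: ((f \o shift (x + h *: delta_mx ord0 k)) (r *: delta_mx ord0 k) -
     f (x + h *: delta_mx ord0 k))).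
  apply/funext => r; rewrite /along /shift /= [r%:A]mulr1.
  by congr (_ *: (f _ - _)); rewrite scalerDl addrCA.
move=> H; split.
  by rewrite /derivable E.
by rewrite /derive E.
Qed.

Lemma near_along Omega x (k : 'I_n) : open Omega -> Omega x ->
  \forall h \near (0 : R), Omega (x + h *: delta_mx ord0 k).
Proof.
move=> oO Ox.
have c : {for (0 : R), continuous (fun h : R => x + h *: delta_mx ord0 k)}.
  apply: (cvgD (F := nbhs (0 : R))); first exact: cvg_cst.
  by apply: cvgZl; exact: cvg_id.
by apply: (c Omega); rewrite scale0r addr0; exact: open_nbhs_nbhs.
Qed.

Lemma Ck2_twice_diff Omega f x k : open Omega -> Ck 2 Omega f -> Omega x ->
  twice_diff (along k f x) 0 (partial k f x) (partial k (partial k f) x).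
Proof.
move=> oO [_ /(_ k)[Hf [_ /(_ k)[Hf' _]]]] Ox.
exists (along k (partial k f) x).
  have := near_along k oO Ox.
  by apply: filterS => y /= Oy; apply: along_is_derive; exact: Hf.
have E : x + 0 *: delta_mx ord0 k = x by rewrite scale0r addr0.
split; first by rewrite /along E.
have := @along_is_derive k (partial k f) x 0; rewrite E; apply.
exact: Hf'.
Qed.

End line.

(** * Cylinders and a maximum principle *)

Section cylinder.
Context {R : realType} {n : nat}.
Implicit Types (x : 'rV[R]_n) (Omega : set 'rV[R]_n).

Definition cylinder Omega : set ('rV[R]_n * R) := closure Omega `*` [set t : R | 0 <= t].

Definition cylinder_upto Omega (T : R) : set ('rV[R]_n * R) :=
  closure Omega `*` `[0, T]%classic.

Lemma cylinder_uptoW Omega T : cylinder_upto Omega T `<=` cylinder Omega.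
Proof. by move=> [x t] [/= cx]; rewrite in_itv /= => /andP[t0 _]. Qed.

Lemma compact_cylinder Omega T : bounded_set Omega -> compact (cylinder_upto Omega T).
Proof.
by move=> bO; apply: compact_setX; [exact: compact_closure|exact: segment_compact].
Qed.

Lemma closure_boundary Omega x : open Omega -> closure Omega x -> Omega x \/ boundary Omega x.
Proof.
move=> /interior_id oO cx; have [Ox|nOx] := pselect (Omega x); [by left|right].
by split => //; rewrite oO.
Qed.

(** A maximum over the compact cylinder exists, and on the parabolic boundary the sign of [G] is
    given. The last hypothesis treats a maximum in [Omega] at a positive time, the top time [T]
    included. *)
Lemma parabolic_maximum Omega (T : R) (G : 'rV[R]_n * R -> R) :
  open Omega -> Omega !=set0 -> bounded_set Omega ->
  {within cylinder Omega, continuous G} ->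
  (forall x (t : R), boundary Omega x -> 0 <= t -> G (x, t) <= 0) ->
  (forall x, closure Omega x -> G (x, 0) <= 0) ->
  (forall x (t : R), Omega x -> 0 < t -> t <= T ->
    (forall (y : 'rV[R]_n) (s : R), closure Omega y -> 0 <= s -> s <= T -> G (y, s) <= G (x, t)) ->
    G (x, t) <= 0) ->
  forall x (t : R), closure Omega x -> 0 <= t -> t <= T -> G (x, t) <= 0.
Proof.
move=> oO [x0 Ox0] bO cG Gb G0 Gmax x t cx t0 tT.
have T0 := le_trans t0 tT.
have ne : cylinder_upto Omega T !=set0.
  by exists (x0, 0); split => /=; [exact: subset_closure|rewrite in_itv /= lexx].
have cG' := continuous_subspaceW (@cylinder_uptoW Omega T) cG.
have [[y s]] := compact_EVT_max ne (compact_cylinder bO) cG'.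
rewrite inE => -[/= cy]; rewrite in_itv /= => /andP[s0 sT] Hmax.
have Hmax' z r : closure Omega z -> 0 <= r -> r <= T -> G (z, r) <= G (y, s).
  by move=> cz r0 rT; apply: Hmax; rewrite inE; split => //=; rewrite in_itv /= r0.
apply: le_trans (Hmax' x t cx t0 tT) _.
have [Oy|by_] := closure_boundary oO cy; last exact: Gb.
move: s0; rewrite le_eqVlt => /predU1P[<-|s0]; first exact: G0.
by apply: Gmax.
Qed.

End cylinder.

(** * The solution: equations for its powers, lower barrier, monotonicity in time *)

Record positive_solution {R : realType} {n : nat} (Omega : set 'rV[R]_n)
    (q gamma m : R) (a : 'rV[R]_n -> R) (u : 'rV[R]_n -> R -> R) : Prop := {
  sol_open : open Omega;
  sol_neq0 : Omega !=set0;
  sol_bounded : bounded_set Omega;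
  sol_q : 0 <= q < 1;
  sol_gamma : 0 <= gamma <= 1;
  sol_m : 0 < m;
  sol_a : forall x, Omega x -> m <= a x;
  sol_C2x : forall t, 0 < t -> Ck 2 Omega (fun x => u x t);
  sol_C1t : forall x t, Omega x -> 0 < t -> derivable (u x) t 1;
  sol_cont : {within cylinder Omega, continuous (fun p : 'rV[R]_n * R => u p.1 p.2)};
  sol_pos : forall x t, Omega x -> 0 < t -> 0 < u x t;
  sol_eq : forall x t, Omega x -> 0 < t ->
     derive1 (u x) t - laplacian (fun y => u y t) x = a x * t `^ gamma * (u x t) `^ q;
  sol_boundary : forall x t, boundary Omega x -> 0 <= t -> u x t = 0;
  sol_initial : forall x, closure Omega x -> u x 0 = 0 }.

Section solution.
Context {R : realType} {n : nat} {Omega : set 'rV[R]_n} {q gamma m : R}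
  {a : 'rV[R]_n -> R} {u : 'rV[R]_n -> R -> R}.
Hypothesis sol : positive_solution Omega q gamma m a u.
Implicit Types (x y : 'rV[R]_n) (s t : R).

Let q0 : 0 <= q. Proof. by case/andP: (sol_q sol). Qed.
Let g0 : 0 <= gamma. Proof. by case/andP: (sol_gamma sol). Qed.
Let q1 : 0 < 1 - q. Proof. by rewrite subr_gt0; case/andP: (sol_q sol). Qed.

Lemma sol_ge0 x t : closure Omega x -> 0 <= t -> 0 <= u x t.
Proof.
move=> cx t0; have [Ox|bx] := closure_boundary (sol_open sol) cx; last first.
  by rewrite (sol_boundary sol).
move: t0; rewrite le_eqVlt => /predU1P[<-|t0]; first by rewrite (sol_initial sol).
by rewrite ltW// (sol_pos sol).
Qed.

Lemma sol_powR_continuous (sigma : R) : 0 < sigma ->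
  {within cylinder Omega, continuous (fun p : 'rV[R]_n * R => u p.1 p.2 `^ sigma)}.
Proof.
move=> s0; apply: (within_continuous_powR s0 (sol_cont sol)).
by move=> [x t] [cx t0]; exact: sol_ge0.
Qed.

(** This and the next two definitions are the chain-rule expressions for the derivatives of
    [u^sigma], kept as closed formulas so that the equation can be transformed by algebra. *)
Definition grad_powR (sigma : R) x s (k : 'I_n) :=
  sigma * u x s `^ (sigma - 1) * partial k (u^~ s) x.

Definition hess_powR (sigma : R) x s (k : 'I_n) :=
  sigma * u x s `^ (sigma - 1) * partial k (partial k (u^~ s)) x
  + sigma * (sigma - 1) * u x s `^ (sigma - 2) * partial k (u^~ s) x ^+ 2.

Definition time_powR (sigma : R) x s :=
  sigma * u x s `^ (sigma - 1) * derive1 (u x) s.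

Lemma sol_twice_diff (sigma : R) x s k : Omega x -> 0 < s ->
  twice_diff (along k (fun y => u y s `^ sigma) x) 0
    (grad_powR sigma x s k) (hess_powR sigma x s k).
Proof.
move=> Ox s0; have := Ck2_twice_diff k (sol_open sol) (sol_C2x sol s0) Ox.
move=> H; have := @twice_diff_powR _ _ sigma _ _ _ _ H.
by rewrite /along scale0r addr0; apply; exact: (sol_pos sol).
Qed.

Lemma sol_is_derive (sigma : R) x s : Omega x -> 0 < s ->
  is_derive s 1 (fun r : R => u x r `^ sigma) (time_powR sigma x s).
Proof.
move=> Ox s0; have us0 := sol_pos sol Ox s0.
have D : is_derive s 1 (u x) (derive1 (u x) s).
  by rewrite derive1E; apply/derivableP/(sol_C1t sol).
exact: is_derive1_comp (is_derive1_powR sigma us0) D.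
Qed.

(** The Laplacian of [u^sigma] is [sigma u^(sigma - 1)] times that of [u] plus a gradient term.
    Inserting the equation and writing that term with the gradient of [u^sigma] itself produces the
    coefficient [1 / sigma - 1]. *)
Lemma sol_laplacian_powR (sigma : R) x s : 0 < sigma -> Omega x -> 0 < s ->
  - (\sum_(k < n) hess_powR sigma x s k) =
    (sigma^-1 - 1) * (\sum_(k < n) grad_powR sigma x s k ^+ 2) / u x s `^ sigma
    + sigma * a x * s `^ gamma * u x s `^ (sigma - 1 + q) - time_powR sigma x s.
Proof.
move=> sg0 Ox s0; have us0 := sol_pos sol Ox s0.
have E := sol_eq sol Ox s0; rewrite /laplacian in E.
set L := \sum_(i < n) _ in E.
rewrite /hess_powR big_split /= -!mulr_sumr -/L.
have -> : L = derive1 (u x) s - a x * s `^ gamma * u x s `^ q by rewrite -E subKr.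
under [in RHS]eq_bigr do rewrite /grad_powR exprMn.
rewrite -mulr_sumr; set P := \sum_(i < n) _.
have une : u x s != 0 by rewrite gt_eqF.
have pD (c d : R) : u x s `^ (c + d) = u x s `^ c * u x s `^ d.
  by apply: powRD; rewrite une; apply/implyP.
have p1 : u x s `^ 1 = u x s by rewrite powRr1// ltW.
have p2 : u x s `^ (sigma - 2) = u x s `^ sigma / u x s ^+ 2.
  rewrite -powR_mulrn ?(ltW us0)// -powRN -pD.
  by [].
have p3 : u x s `^ (sigma - 1) = u x s `^ sigma / u x s.
  by rewrite -{3}p1 -powRN -pD.
rewrite (pD (sigma - 1) q) p2 /time_powR p3.
have un : u x s `^ sigma != 0 by rewrite gt_eqF// powR_gt0.
move: (u x s `^ sigma) (u x s) (u x s `^ q) (derive1 _ _) (s `^ gamma) un une => A B C D F un une.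
by field; rewrite un une gt_eqF.
Qed.

Let sigma := 1 - q.

Lemma sol_laplacian_sigma x s : Omega x -> 0 < s ->
  - (\sum_(k < n) hess_powR sigma x s k) =
    (sigma^-1 - 1) * (\sum_(k < n) grad_powR sigma x s k ^+ 2) / u x s `^ sigma
    + sigma * a x * s `^ gamma - time_powR sigma x s.
Proof.
move=> Ox s0; rewrite sol_laplacian_powR//.
by rewrite [sigma - 1 + q](_ : _ = 0) ?powRr0 ?mulr1// /sigma; ring.
Qed.

Let K0 : 0 <= sigma^-1 - 1.
Proof. by rewrite subr_ge0 invf_ge1// /sigma gerBl. Qed.

(** At a touching point the barrier's time derivative is at most [2 c t^gamma] and minus its
    Laplacian at most [2 n c t^gamma], while the source is at least [sigma m t^gamma]. The 3 in
    place of 2 leaves strict slack. *)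
Definition barrier_const := sigma * m / (3 + 2 * n%:R).

Lemma barrier_const_gt0 : 0 < barrier_const.
Proof.
by rewrite divr_gt0 ?mulr_gt0 ?(sol_m sol)// ltr_pwDl// mulr_ge0.
Qed.

Lemma sqnorm_quadratic x y (k : 'I_n) (h : R) :
  sqnorm (x + h *: delta_mx ord0 k - y) =
  sqnorm (x - y) + 2 * h * (x - y) ord0 k + h ^+ 2.
Proof.
have -> : x + h *: delta_mx ord0 k - y = h *: delta_mx ord0 k - (y - x).
  by rewrite opprB addrAC addrC.
have -> : y - x = -1 *: (x - y) by rewrite scaleN1r opprB.
by rewrite sqnorm_shift (sqnormZ (-1)) [X in 2 * h * X]mxE; ring.
Qed.

Lemma twice_diff_quadratic (A B C : R) :
  twice_diff (fun h : R => A + B * h + C * h ^+ 2) 0 B (2 * C).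
Proof.
have T1 := twice_diff_id (0 : R).
have T2 := twice_diffZ C (twice_diffM T1 T1).
have T3 := twice_diffD (twice_diffD (twice_diff_cst A 0) (twice_diffZ B T1)) T2.
move: T3; rewrite !(mulr0, mul0r, mulr1, mul1r, addr0, add0r).
by rewrite [C * 2]mulrC /cst /=; under eq_fun do rewrite -expr2.
Qed.

(* The power [u `^ (1 - q)] satisfies an equation whose right-hand side no
   longer degenerates, so a separated quadratic is a strict subsolution. *)
Lemma sol_barrier x y (rho s : R) : closure Omega x -> 0 < rho -> 0 < s ->
  s <= rho ^+ 2 -> eucl_ball y rho `<=` Omega ->
  barrier_const * s `^ (1 + gamma) * (1 - sqnorm (x - y) / rho ^+ 2) <= u x s `^ sigma.
Proof.
move=> cx rho0 s0 srho yO; rewrite -subr_le0.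
have c0 := barrier_const_gt0; set c := barrier_const in c0 *.
have g10 : 0 < 1 + gamma by rewrite ltr_pwDl.
have r20 : 0 < rho ^+ 2 by rewrite exprn_gt0.
pose G (p : 'rV[R]_n * R) := c * p.2 `^ (1 + gamma) * (1 - sqnorm (p.1 - y) / rho ^+ 2)
   - u p.1 p.2 `^ sigma.
have H := @parabolic_maximum _ _ Omega (rho ^+ 2) G (sol_open sol) (sol_neq0 sol)
  (sol_bounded sol) _ _ _ _ x s cx (ltW s0) srho.
apply: H.
- apply: within_continuousD; last exact/within_continuousN/sol_powR_continuous.
  apply: within_continuousM; first apply: within_continuousM.
  + by apply: continuous_subspaceT => z; exact: cvg_cst.
  + apply: (within_continuous_powR g10).
      by apply: continuous_subspaceT => z; exact: cvg_snd.
    by move=> [z t] [].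
  + apply: continuous_subspaceT => z.
    apply: (cvgB (F := nbhs z)); first exact: cvg_cst.
    apply: (cvgMl (F := nbhs z)).
    apply: (@continuous_comp _ _ _ fst (fun x' => sqnorm (x' - y)) z).
      exact: cvg_fst.
    exact: sqnorm_continuous.
(* Boundary points of [Omega] lie outside the open ball, so the quadratic factor is at most 0
   there. *)
- move=> z t bz t0; rewrite /G /= (sol_boundary sol)// powR0 ?gt_eqF// subr0.
  apply: mulr_ge0_le0; first by rewrite mulr_ge0 ?powR_ge0 ?(ltW c0).
  rewrite subr_le0 ler_pdivlMr// mul1r.
  rewrite leNgt; apply/negP => /(eucl_ballE _ _ rho0) /yO Oz.
  by case: bz => _; rewrite (interior_id _).1//; exact: sol_open sol.
- move=> z cz; rewrite /G /= (sol_initial sol)// !powR0 ?gt_eqF//.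
  by rewrite mulr0 mul0r subr0.
move=> z t Oz t0 tr Gmax; exfalso.
have time : 0 <= c * ((1 + gamma) * t `^ gamma) *
    (1 - sqnorm (z - y) / rho ^+ 2) - time_powR sigma z t.
  have Dt : is_derive t 1 (fun r : R => G (z, r))
    (c * ((1 + gamma) * t `^ gamma) * (1 - sqnorm (z - y) / rho ^+ 2) - time_powR sigma z t).
    rewrite /G /=; apply: is_deriveB; last exact: (sol_is_derive sigma Oz t0).
    have := is_derive1_powR (1 + gamma) t0; rewrite [1 + gamma - 1]addrC addKr.
    move=> /(is_deriveZ (c * (1 - sqnorm (z - y) / rho ^+ 2))).
    rewrite /GRing.scale /=.
    have -> : (c * (1 - sqnorm (z - y) / rho ^+ 2)) \*: (fun r : R => r `^ (1 + gamma)) =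
      (fun r => c * r `^ (1 + gamma) * (1 - sqnorm (z - y) / rho ^+ 2)).
      by apply/funext => r /=; rewrite /GRing.scale /=; ring.
    by rewrite mulrAC mulrA.
  apply: (is_derive_left_max Dt); near=> h; apply: Gmax; first exact: subset_closure.
    by rewrite subr_ge0; near: h; exact: nbhs_right_le.
  by rewrite (le_trans _ tr)// gerBl; near: h; exact: nbhs_right_ge.
(* Each pure second derivative of the barrier equals [- (2 * T)]. *)
set T := c * t `^ (1 + gamma) / rho ^+ 2.
have space k : - (2 * T) - hess_powR sigma z t k <= 0.
  have TT := twice_diffD (twice_diff_quadratic
    (c * t `^ (1 + gamma) * (1 - sqnorm (z - y) / rho ^+ 2))
    (- (2 * T * (z - y) ord0 k)) (- T)) (twice_diffZ (- 1) (sol_twice_diff sigma k Oz t0)).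
  have E h : G (z + h *: delta_mx ord0 k, t) =
     c * t `^ (1 + gamma) * (1 - sqnorm (z - y) / rho ^+ 2)
     + - (2 * T * (z - y) ord0 k) * h + - T * h ^+ 2
     + (-1) * along k (fun y0 => u y0 t `^ sigma) z h.
    by rewrite /G /= sqnorm_quadratic /along /T; field; rewrite gt_eqF.
  have [|_] := twice_diff_max TT; last by rewrite mulN1r mulrN.
  have := near_along k (sol_open sol) Oz; apply: filterS => h Oh.
  have E0 := E 0; rewrite scale0r addr0 in E0; rewrite -E -E0.
  by apply: Gmax => //; [exact: subset_closure|exact: ltW].
have spaces : - (n%:R * (2 * T)) - \sum_(k < n) hess_powR sigma z t k <= 0.
  have -> : - (n%:R * (2 * T)) - \sum_(k < n) hess_powR sigma z t k =
      \sum_(k < n) (- (2 * T) - hess_powR sigma z t k).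
    by rewrite sumrB sumr_const card_ord mulNrn mulr_natl.
  by apply: sumr_le0 => k _; exact: space.
rewrite (sol_laplacian_sigma Oz t0) in spaces.
have tg0 : 0 < t `^ gamma by exact: powR_gt0.
(* The restriction [t <= rho ^+ 2] absorbs the Laplacian of the barrier into the scale [c t^gamma]
   of the source. *)
have B1 : T <= c * t `^ gamma.
  have -> : T = c * t `^ gamma * (t / rho ^+ 2).
    rewrite /T powRD ?powRr1 ?(ltW t0)//; first by ring.
    by rewrite (gt_eqF t0); apply/implyP.
  apply: ler_piMr; first by rewrite mulr_ge0 ?(ltW c0) ?(ltW tg0).
  by rewrite ler_pdivrMr// mul1r.
have B2 : c * ((1 + gamma) * t `^ gamma) * (1 - sqnorm (z - y) / rho ^+ 2) <= 2 * (c * t `^ gamma).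
  have eta1 : 1 - sqnorm (z - y) / rho ^+ 2 <= 1.
    by rewrite gerBl divr_ge0 ?sqnorm_ge0// ltW.
  have g2 : 1 + gamma <= 2 by case/andP: (sol_gamma sol); lra.
  have -> : 2 * (c * t `^ gamma) = c * (2 * t `^ gamma) * 1 by ring.
  apply: le_trans (ler_wpM2l _ eta1) _.
    by apply: mulr_ge0; [exact: ltW|apply: mulr_ge0; exact: ltW].
  by rewrite ler_wpM2r// ler_wpM2l ?(ltW c0)// ler_wpM2r// ltW.
have B3 : 0 <= (sigma^-1 - 1) * (\sum_(k < n) grad_powR sigma z t k ^+ 2) / u z t `^ sigma.
  apply: divr_ge0; last exact: powR_ge0.
  by apply: mulr_ge0; [exact: K0|apply: sumr_ge0 => k _; exact: sqr_ge0].
have B4 : sigma * m * t `^ gamma <= sigma * a z * t `^ gamma.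
  apply: ler_wpM2r; first exact: ltW.
  by apply: ler_wpM2l; [exact: ltW|exact: (sol_a sol)].
have B5 : n%:R * (2 * T) <= n%:R * (2 * (c * t `^ gamma)) by rewrite ler_wpM2l// ler_wpM2l.
have B6 : sigma * m * t `^ gamma = (3 + 2 * n%:R) * (c * t `^ gamma).
  by rewrite /c /barrier_const; field; rewrite gt_eqF// ltr_pwDl// mulr_ge0.
have B7 : 0 < c * t `^ gamma by rewrite mulr_gt0.
lra.
Unshelve. all: by end_near.
Qed.

(** The solution is compared with its time shift, whose source is larger because [t^gamma] is
    nondecreasing. The penalty [d * s] makes the comparison strict: at a positive maximum the
    gradients agree, the gradient and source terms favour the shift, and the time derivatives still
    differ by at least [d]. *)
Lemma sol_monotone_sigma x s (h : R) : closure Omega x -> 0 <= s -> 0 <= h ->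
  u x s `^ sigma <= u x (s + h) `^ sigma.
Proof.
move=> cx s0 h0.
have mono d : 0 < d -> u x s `^ sigma - d * s - u x (s + h) `^ sigma <= 0.
  move=> d0.
  pose G (p : 'rV[R]_n * R) := u p.1 p.2 `^ sigma - d * p.2 - u p.1 (p.2 + h) `^ sigma.
  have H := @parabolic_maximum _ _ Omega s G (sol_open sol) (sol_neq0 sol)
    (sol_bounded sol) _ _ _ _ x s cx s0 (lexx s).
  apply: H.
  - apply: within_continuousD.
      apply: within_continuousD; first exact: sol_powR_continuous.
      apply: within_continuousN; apply: within_continuousM.
        by apply: continuous_subspaceT => z; exact: cvg_cst.
      by apply: continuous_subspaceT => z; exact: cvg_snd.
    apply: within_continuousN.
    refine (@within_continuous_comp_in _ _ _ (cylinder Omega) (cylinder Omega)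
      (fun p : 'rV[R]_n * R => (p.1, p.2 + h)) (fun p => u p.1 p.2 `^ sigma) _ _ _).
    + exact: sol_powR_continuous.
    + apply: continuous_subspaceT => z.
      apply: (cvg_pair (F := nbhs z) (G := nbhs z.1) (H := nbhs (z.2 + h))); first exact: cvg_fst.
      by apply: (cvgD (F := nbhs z)); [exact: cvg_snd|exact: cvg_cst].
    + by move=> [z t] [cz t0]; split => //=; rewrite addr_ge0.
  - move=> z t bz t0; rewrite /G /= !(sol_boundary sol)// ?addr_ge0//.
    by rewrite powR0 ?gt_eqF// !subr0 sub0r oppr_le0 mulr_ge0// ltW.
  - move=> z cz; rewrite /G /= (sol_initial sol)// powR0 ?gt_eqF//.
    by rewrite mulr0 subr0 sub0r oppr_le0 powR_ge0.
  move=> z t Oz t0 ts Gmax; rewrite leNgt; apply/negP => Gpos.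
  have th0 : 0 < t + h by rewrite ltr_pwDl.
  have time : 0 <= time_powR sigma z t - d - time_powR sigma z (t + h).
    have Dt : is_derive t 1 (fun r : R => G (z, r))
      (time_powR sigma z t - d - time_powR sigma z (t + h)).
      rewrite /G /=; apply: is_deriveB.
        apply: is_deriveB; first exact: (sol_is_derive sigma Oz t0).
        by rewrite -[X in is_derive _ _ _ X]mulr1; exact: (is_deriveZ (f := id) d).
      rewrite -[X in is_derive _ _ _ X]mulr1.
      have Ds : is_derive t 1 (fun r : R => r + h) 1 by exact: is_derive_shift.
      exact: (@is_derive1_comp _ (fun r : R => u z r `^ sigma) (fun r : R => r + h) t _ _
        (sol_is_derive sigma Oz th0) Ds).
    apply: (is_derive_left_max Dt); near=> r; apply: Gmax; first exact: subset_closure.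
      by rewrite subr_ge0; near: r; exact: nbhs_right_le.
    by rewrite (le_trans _ ts)// gerBl; near: r; exact: nbhs_right_ge.
  have space k : grad_powR sigma z t k = grad_powR sigma z (t + h) k /\
       hess_powR sigma z t k - hess_powR sigma z (t + h) k <= 0.
    have TT := twice_diffD (sol_twice_diff sigma k Oz t0)
       (twice_diffZ (- 1) (sol_twice_diff sigma k Oz th0)).
    have [|] := twice_diff_max TT; last first.
      by rewrite !mulN1r => /eqP; rewrite subr_eq0 => /eqP -> ->.
    have := near_along k (sol_open sol) Oz; apply: filterS => r Or.
    have E b : along k (fun y0 => u y0 t `^ sigma) z b +
        -1 * along k (fun y0 => u y0 (t + h) `^ sigma) z b =
      G (z + b *: delta_mx ord0 k, t) + d * t.
      by rewrite /G /along /=; ring.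
    rewrite !E lerD2r scale0r addr0.
    by apply: Gmax => //; [exact: subset_closure|exact: ltW].
  have spaces : \sum_(k < n) hess_powR sigma z t k - \sum_(k < n) hess_powR sigma z (t + h) k <= 0.
    by rewrite -sumrB; apply: sumr_le0 => k _; case: (space k).
  have E1 := sol_laplacian_sigma Oz t0.
  have E2 := sol_laplacian_sigma Oz th0.
  have gr : \sum_(k < n) grad_powR sigma z (t + h) k ^+ 2 = \sum_(k < n) grad_powR sigma z t k ^+ 2.
    by apply: eq_bigr => k _; case: (space k) => ->.
  rewrite gr in E2.
  have U2 : 0 < u z (t + h) `^ sigma by rewrite powR_gt0// (sol_pos sol).
  have U1 : 0 < u z t `^ sigma by rewrite powR_gt0// (sol_pos sol).
  have U12 : u z (t + h) `^ sigma <= u z t `^ sigma.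
    have dt : 0 < d * t by rewrite mulr_gt0.
    by move: Gpos; rewrite /G /=; lra.
  have A1 : (sigma^-1 - 1) * (\sum_(k < n) grad_powR sigma z t k ^+ 2) / u z t `^ sigma <=
     (sigma^-1 - 1) * (\sum_(k < n) grad_powR sigma z t k ^+ 2) / u z (t + h) `^ sigma.
    apply: ler_wpM2l; last by rewrite lef_pV2.
    by apply: mulr_ge0; [exact: K0|apply: sumr_ge0 => k _; exact: sqr_ge0].
  have A2 : sigma * a z * t `^ gamma <= sigma * a z * (t + h) `^ gamma.
    rewrite ler_wpM2l//; last by rewrite ge0_ler_powR ?nnegrE ?(ltW t0) ?(ltW th0)// lerDl.
    by rewrite mulr_ge0 ?(ltW q1)// (le_trans (ltW (sol_m sol)))// (sol_a sol).
  lra.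
rewrite leNgt; apply/negP => lt_u.
pose D := u x s `^ sigma - u x (s + h) `^ sigma.
have D0 : 0 < D by rewrite subr_gt0.
have s10 : 0 < s + 1 by rewrite ltr_wpDl.
(* With this [d] the penalty [d * s] stays below the assumed violation [D]. *)
have := mono (D / (s + 1)) (divr_gt0 D0 s10).
have : D / (s + 1) * s < D.
  by rewrite mulrAC ltr_pdivrMr// mulrDr mulr1 ltrDl.
by rewrite /D; lra.
Unshelve. all: by end_near.
Qed.

Lemma sol_monotone x s t : closure Omega x -> 0 <= s -> s <= t -> u x s <= u x t.
Proof.
move=> cx s0 st; have t0 := le_trans s0 st.
have ts : 0 <= t - s by rewrite subr_ge0.
have := sol_monotone_sigma cx s0 ts; rewrite subrKC => H.
rewrite leNgt; apply/negP => tu.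
have := gt0_ltr_powR q1 _ _ tu; rewrite !nnegrE !sol_ge0// => /(_ isT isT).
by rewrite ltNge H.
Qed.

Lemma sol_derive1_ge0 x t : Omega x -> 0 < t -> 0 <= derive1 (u x) t.
Proof.
move=> Ox t0; have Dt : is_derive t 1 (u x) (derive1 (u x) t).
  by rewrite derive1E; apply/derivableP/(sol_C1t sol).
apply: (is_derive_left_max Dt).
near=> h; apply: sol_monotone; first exact: subset_closure.
  by rewrite subr_ge0; near: h; exact: nbhs_right_le.
by rewrite gerBl; near: h; exact: nbhs_right_ge.
Unshelve. all: by end_near.
Qed.

End solution.

(** * Concavity of the rescaled power for [1 <= beta < 2] *)

Section concavity.
Context {R : realType} {n : nat} {Omega : set 'rV[R]_n} {q gamma m : R}
  {a : 'rV[R]_n -> R} {u : 'rV[R]_n -> R -> R}.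
Hypothesis sol : positive_solution Omega q gamma m a u.
Hypothesis n_gt0 : (0 < n)%N.
Hypothesis Omega_convex : convex_set (Omega : set (convex_lmodType 'rV[R]_n)).
Hypothesis Omega_sphere : interior_sphere Omega.
Context {beta omega : R}.
Hypothesis beta1 : 1 <= beta.
Hypothesis beta2 : beta < 2.
Hypothesis omega0 : 0 <= omega.
Implicit Types (x y : 'rV[R]_n) (s t l T : R) (k : 'I_n).

Let g := beta * gamma.
Let alpha := (1 - q) / (2 + g + omega).
(** Since [alpha = (1 - q) * eps], this power converts bounds on [u^(1 - q)] into bounds on [V]. *)
Let eps := (2 + g + omega)^-1.

Let beta0 : 0 < beta. Proof. exact: lt_le_trans beta1. Qed.
Let gamma0 : 0 <= gamma. Proof. by case/andP: (sol_gamma sol). Qed.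
Let g0 : 0 <= g. Proof. by rewrite mulr_ge0// ltW. Qed.
Let q0 : 0 <= q. Proof. by case/andP: (sol_q sol). Qed.
Let q1 : 0 < 1 - q. Proof. by rewrite subr_gt0; case/andP: (sol_q sol). Qed.
Let den0 : 0 < 2 + g + omega. Proof. by rewrite -addrA ltr_pwDl// addr_ge0. Qed.
Let eps0 : 0 < eps. Proof. by rewrite invr_gt0. Qed.
Let alpha0 : 0 < alpha. Proof. exact: divr_gt0. Qed.
Let alpha1 : alpha <= 1.
Proof. by rewrite ler_pdivrMr// mul1r; move: q0 g0 omega0; lra. Qed.

Definition rescaled (alpha beta : R) x t : R := u x (t `^ beta) `^ alpha.
Let V := rescaled alpha beta.

Lemma rescaled_ge0 x t : 0 <= V x t. Proof. exact: powR_ge0. Qed.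

Lemma rescaled_gt0 x t : Omega x -> 0 < t -> 0 < V x t.
Proof. by move=> Ox t0; rewrite powR_gt0// (sol_pos sol)// powR_gt0. Qed.

Lemma rescaled_eq0 x t : closure Omega x -> 0 <= t -> boundary Omega x \/ t = 0 -> V x t = 0.
Proof.
rewrite /V /rescaled => cx t0 [bx|->].
  by rewrite (sol_boundary sol) ?powR_ge0// powR0// gt_eqF.
by rewrite (powR0 (lt0r_neq0 beta0)) (sol_initial sol)// powR0// gt_eqF.
Qed.

Lemma rescaled_within_continuous :
  {within cylinder Omega, continuous (fun p : 'rV[R]_n * R => V p.1 p.2)}.
Proof.
apply: (@within_continuous_comp_in _ _ _ (cylinder Omega) (cylinder Omega)
  (fun p : 'rV[R]_n * R => (p.1, p.2 `^ beta)) (fun p => u p.1 p.2 `^ alpha)).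
- exact: (sol_powR_continuous sol).
- apply/subspace_continuousP => z Kz.
  apply: (cvg_pair (F := within (cylinder Omega) (nbhs z))
    (G := nbhs z.1) (H := nbhs (z.2 `^ beta))).
    by apply: cvg_within_filter; exact: cvg_fst.
  have : {within cylinder Omega, continuous (fun p : 'rV[R]_n * R => p.2 `^ beta)}.
    apply: (within_continuous_powR beta0); last by move=> [x t] [].
    by apply: continuous_subspaceT => w; exact: cvg_snd.
  by move/subspace_continuousP/(_ z Kz).
- by move=> [x t] [cx t0]; split => //=; exact: powR_ge0.
Qed.

Definition gradV x t k := grad_powR (u := u) alpha x (t `^ beta) k.
Definition hessV x t k := hess_powR (u := u) alpha x (t `^ beta) k.
Definition timeV x t := time_powR (u := u) alpha x (t `^ beta) * (beta * t `^ (beta - 1)).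

Lemma rescaled_twice_diff x t k : Omega x -> 0 < t ->
  twice_diff (along k (fun y => V y t) x) 0 (gradV x t k) (hessV x t k).
Proof. by move=> Ox t0; apply: (sol_twice_diff sol) => //; exact: powR_gt0. Qed.

Lemma rescaled_is_derive x t : Omega x -> 0 < t -> is_derive t 1 (V x) (timeV x t).
Proof.
move=> Ox t0; have tb : 0 < t `^ beta by exact: powR_gt0.
exact: (@is_derive1_comp _ (fun r : R => u x r `^ alpha) (fun r : R => r `^ beta) t _ _
  (sol_is_derive sol alpha Ox tb) (is_derive1_powR beta t0)).
Qed.

Lemma rescaled_time_ge0 x t : Omega x -> 0 < t -> 0 <= timeV x t.
Proof.
move=> Ox t0; have tb : 0 < t `^ beta by exact: powR_gt0.
apply: mulr_ge0; last by apply: mulr_ge0; [exact: ltW|exact: powR_ge0].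
apply: mulr_ge0; last exact: (sol_derive1_ge0 sol).
by apply: mulr_ge0; [exact: ltW|exact: powR_ge0].
Qed.

(** The choice of [alpha] gives [alpha - 1 + q = - alpha (1 + g + omega)], so the source depends on
    the solution through [V] alone. The weight on [timeV] undoes the factor [beta t^(beta - 1)] of
    the time change. *)
Lemma rescaled_equation x t : Omega x -> 0 < t ->
  - (\sum_(k < n) hessV x t k) =
  (alpha^-1 - 1) * (\sum_(k < n) gradV x t k ^+ 2) / V x t
  + alpha * a x * t `^ g * V x t `^ (- (1 + g + omega))
  - beta^-1 * t `^ (1 - beta) * timeV x t.
Proof.
move=> Ox t0; have tb : 0 < t `^ beta by exact: powR_gt0.
have E1 : (t `^ beta) `^ gamma = t `^ g by rewrite -powRrM.
have E2 : V x t `^ (- (1 + g + omega)) = u x (t `^ beta) `^ (alpha - 1 + q).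
  rewrite /V /rescaled -powRrM; congr (_ `^ _).
  by rewrite /alpha; field; rewrite gt_eqF.
rewrite (sol_laplacian_powR sol alpha0 Ox tb) E1 E2.
congr (_ + _ - _).
rewrite /timeV.
have : t `^ (1 - beta) * t `^ (beta - 1) = 1.
  rewrite -powRD; last by rewrite (gt_eqF t0); apply/implyP.
  by rewrite addrA subrK subrr powRr0.
move: (t `^ (1 - beta)) (t `^ (beta - 1)) (time_powR _ _ _) => A B C AB.
have -> : beta^-1 * A * (C * (beta * B)) = (A * B) * (beta^-1 * beta) * C by ring.
by rewrite AB mulVf ?gt_eqF// !mul1r.
Qed.

(** Transfers the barrier bound to [V]: growth of order [p] becomes growth of order [p * eps], which
    is below 1 as soon as [p < 2 + g + omega]. *)
Lemma rescaled_lower_bound x s (c p h : R) : 0 < c -> 0 < h ->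
  c * h `^ p <= u x s `^ (1 - q) -> c `^ eps * h `^ (p * eps) <= u x s `^ alpha.
Proof.
move=> c0 h0 H; rewrite /alpha [X in _ <= _ `^ X](_ : _ = (1 - q) * eps)//.
rewrite !powRrM -powRM ?powR_ge0 ?(ltW c0)//.
by rewrite ge0_ler_powR ?nnegrE ?powR_ge0 ?(ltW eps0)// mulr_ge0 ?powR_ge0// ltW.
Qed.

Let barrier := sol_barrier sol.

(* At every point of the parabolic boundary [V] vanishes but grows faster than
   linearly in a suitable direction. *)
Lemma steep_boundary x t : closure Omega x -> 0 <= t -> boundary Omega x \/ t = 0 ->
  exists k, exists e kappa c mu : R, [/\ 0 < c, mu < 1, 0 <= kappa, kappa = 0 \/ t = 0 &
    \forall h \near (0 : R)^'+, closure Omega (x + (h * e) *: delta_mx ord0 k) /\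
      c * h `^ mu <= V (x + (h * e) *: delta_mx ord0 k) (t + kappa * h)].
Proof.
move=> cx t0 bad; have C0 := barrier_const_gt0 sol.
set C := barrier_const in C0.
have mu1 (p : R) : p < 2 + g + omega -> p * eps < 1 by move=> ?; rewrite ltr_pdivrMr// mul1r.
have small (b d : R) : 0 < b -> 0 < d -> \forall h \near (0 : R)^'+, h `^ b <= d.
  by move=> b0 d0; exact: (cvgr_le 0 (powR_cvg0 b0)).
have [Ox|bx] := closure_boundary (sol_open sol) cx.
  have {bad}te : t = 0.
    case: bad => // -[_]; rewrite (interior_id _).1//; exact: sol_open sol.
  subst t.
  (* Interior point at time 0: a fixed ball centred at [x] and a motion in time only. The order
     [beta (1 + gamma) = beta + g] is admissible because [beta < 2]. *)
  have [r r0 rO] := open_eucl_ball (sol_open sol) Ox.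
  exists (Ordinal n_gt0), 0, 1, (C `^ eps), (beta * (1 + gamma) * eps); split => //.
  - exact: powR_gt0.
  - by apply: mu1; rewrite mulrDr mulr1 -/g; move: beta2 omega0; lra.
  - by right.
  near=> h.
  have h0 : 0 < h by near: h; exact: nbhs_right_gt.
  rewrite mulr0 scale0r addr0 add0r mul1r; split => //.
  apply: rescaled_lower_bound => //; rewrite powRrM.
  have hr : h `^ beta <= r ^+ 2 by near: h; apply: small; rewrite ?exprn_gt0.
  have := barrier cx r0 (powR_gt0 beta h0) hr rO.
  rewrite subrr [X in 1 - X](_ : _ = 0) ?subr0 ?mulr1//.
  by rewrite /sqnorm big1 ?mul0r// => i _; rewrite !mxE expr0n.
have [r [c [e [k [r0 c0 H]]]]] := tangent_balls Omega_sphere bx.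
have {bad}[te|t0'] : t = 0 \/ 0 < t.
  by move: t0; rewrite le_eqVlt => /predU1P[<-|]; [left|right].
  subst t.
  (* Corner: the point moves inwards and forwards in time, below a tangent ball of radius
     [rho = h^(beta / 2)], so that the time [h^beta] equals [rho ^+ 2]. The quadratic factor is of
     order [h / rho = h^(1 - beta / 2)], and the total order [1 + beta / 2 + g] is below [2 + g] for
     [beta < 2]. *)
  exists k, e, 1, ((C * c) `^ eps), ((beta * (1 + gamma) + (1 - beta / 2)) * eps); split => //.
  - by rewrite powR_gt0// mulr_gt0.
  - by apply: mu1; rewrite mulrDr mulr1 -/g; move: beta2 omega0; lra.
  - by right.
  near=> h.
  have h0 : 0 < h by near: h; exact: nbhs_right_gt.
  rewrite add0r mul1r.
  have rhor : h `^ (beta / 2) <= r by near: h; apply: small; rewrite ?divr_gt0.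
  have hc : h `^ (1 - beta / 2) <= c by near: h; apply: small => //; move: beta2; lra.
  move: rhor; set rho := h `^ (beta / 2) => rhor.
  have rho0 : 0 < rho by exact: powR_gt0.
  have rho2 : rho ^+ 2 = h `^ beta.
    by rewrite -powR_mulrn ?powR_ge0// -powRrM; congr (_ `^ _); field.
  have hrho : h = rho * h `^ (1 - beta / 2).
    rewrite -powRD; last by rewrite (gt_eqF h0); apply/implyP.
    by rewrite subrKC powRr1// ltW.
  have [y [yO Hy]] := H rho rho0 rhor.
  have hh : h ^+ 2 <= h * rho * c by rewrite expr2 -mulrA ler_pM2l// {1}hrho ler_pM2l.
  have hp : 0 < h * rho * c by rewrite !mulr_gt0.
  have inO : Omega (x + (h * e) *: delta_mx ord0 k).
    by apply: yO; apply/(eucl_ballE _ _ rho0); rewrite Hy; lra.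
  split; first exact: subset_closure.
  apply: rescaled_lower_bound => //; first exact: mulr_gt0.
  have sr : h `^ beta <= rho ^+ 2 by rewrite rho2.
  apply: le_trans (barrier (subset_closure inO) rho0 (powR_gt0 beta h0) sr yO).
  have EA : h `^ (beta * (1 + gamma) + (1 - beta / 2)) =
      (h `^ beta) `^ (1 + gamma) * h `^ (1 - beta / 2).
    by rewrite powRD; [rewrite powRrM|rewrite (gt_eqF h0); apply/implyP].
  have A0 : 0 < (h `^ beta) `^ (1 + gamma) by rewrite !powR_gt0.
  rewrite Hy EA; move: A0 hrho; set A := (h `^ beta) `^ _; set B := h `^ (1 - _) => A0 hrho.
  have -> : C * c * (A * B) = C * A * (c * B) by ring.
  rewrite ler_pM2l; last exact: mulr_gt0.
  have -> : 1 - (rho ^+ 2 - 2 * h * rho * c + h ^+ 2) / rho ^+ 2 =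
    (2 * (h * rho * c) - h ^+ 2) / rho ^+ 2 by field; rewrite gt_eqF.
  rewrite ler_pdivlMr ?exprn_gt0//.
  have -> : c * B * rho ^+ 2 = h * rho * c by rewrite {1}hrho; ring.
  by lra.
have tb : 0 < t `^ beta by exact: powR_gt0.
(* Lateral boundary at positive time: the motion is in space only. The barrier gives linear growth
   of [u^(1 - q)] at the admissible time [s], and monotonicity carries it to [t^beta]. *)
pose s := Num.min (t `^ beta) (r ^+ 2).
have s0 : 0 < s by rewrite lt_min tb exprn_gt0.
have D1 : 0 < C * s `^ (1 + gamma) by apply: mulr_gt0 => //; exact: powR_gt0.
have D0 : 0 < C * s `^ (1 + gamma) * (c / r) by apply: mulr_gt0 => //; exact: divr_gt0.
exists k, e, 0, ((C * s `^ (1 + gamma) * (c / r)) `^ eps), (1 * eps); split => //.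
- exact: powR_gt0.
- by apply: mu1; move: g0 omega0; lra.
- by left.
have [y [yO Hy]] := H r r0 (lexx r).
near=> h.
have h0 : 0 < h by near: h; exact: nbhs_right_gt.
have hc : h <= r * c by near: h; apply: nbhs_right_le; exact: mulr_gt0.
have hh : h ^+ 2 <= h * r * c by rewrite expr2 -mulrA ler_pM2l.
have hp : 0 < h * r * c by rewrite !mulr_gt0.
have inO : Omega (x + (h * e) *: delta_mx ord0 k).
  by apply: yO; apply/(eucl_ballE _ _ r0); rewrite Hy; lra.
have cO := subset_closure inO.
split => //; rewrite mul0r addr0.
apply: (@le_trans _ _ (u (x + (h * e) *: delta_mx ord0 k) s `^ alpha)); last first.
  rewrite ge0_ler_powR ?nnegrE ?(ltW alpha0) ?(sol_ge0 sol) ?(ltW s0) ?(ltW tb)//.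
  by apply: (sol_monotone sol) => //; rewrite ?(ltW s0)// ge_min lexx.
apply: rescaled_lower_bound => //.
have sr : s <= r ^+ 2 by rewrite ge_min lexx orbT.
apply: le_trans (barrier cO r0 s0 sr yO).
rewrite Hy powRr1 ?(ltW h0)// -[leLHS]mulrA ler_pM2l//.
have -> : 1 - (r ^+ 2 - 2 * h * r * c + h ^+ 2) / r ^+ 2 =
    (2 * (h * r * c) - h ^+ 2) / r ^+ 2 by field; rewrite gt_eqF.
rewrite ler_pdivlMr ?exprn_gt0//.
have -> : c / r * h * r ^+ 2 = h * r * c by field; rewrite gt_eqF.
by lra.
Unshelve. all: by end_near.
Qed.

(** The only assumption on the shape of [a]. It is obtained below from [powR3_concave] with weights
    [omega], [g] and [1 - g - omega]. *)
Hypothesis source_concave : forall l x1 x3 (t1 t3 v1 v3 : R), 0 < l < 1 ->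
  Omega x1 -> Omega x3 -> 0 < t1 -> 0 < t3 -> 0 < v1 -> 0 < v3 ->
  l * (a x1 * t1 `^ g * v1 `^ (1 - g - omega)) +
  (1 - l) * (a x3 * t3 `^ g * v3 `^ (1 - g - omega)) <=
  a (l *: x1 + (1 - l) *: x3) * (l * t1 + (1 - l) * t3) `^ g *
    (l * v1 + (1 - l) * v3) `^ (1 - g - omega).

(* Korevaar's concavity function, with the opposite sign. *)
Definition defect l x1 t1 x3 t3 :=
  l * V x1 t1 + (1 - l) * V x3 t3 - V (l *: x1 + (1 - l) *: x3) (l * t1 + (1 - l) * t3).

Definition maximal_defect l T x1 t1 x3 t3 :=
  forall y1 (s1 : R) y3 (s3 : R), closure Omega y1 -> 0 <= s1 -> s1 <= T ->
    closure Omega y3 -> 0 <= s3 -> s3 <= T ->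
    defect l y1 s1 y3 s3 <= defect l x1 t1 x3 t3.

(** Lets each argument about the first point be reused for the second. *)
Lemma defect_swap l x1 t1 x3 t3 : defect (1 - l) x3 t3 x1 t1 = defect l x1 t1 x3 t3.
Proof.
have Ex : (1 - l) *: x3 + l *: x1 = l *: x1 + (1 - l) *: x3 := addrC _ _.
have Et : (1 - l) * t3 + l * t1 = l * t1 + (1 - l) * t3 := addrC _ _.
have Ev : (1 - l) * V x3 t3 + l * V x1 t1 = l * V x1 t1 + (1 - l) * V x3 t3 := addrC _ _.
rewrite /defect subKr Ex Et.
exact: (congr1 (fun b => b - V (l *: x1 + (1 - l) *: x3) (l * t1 + (1 - l) * t3)) Ev).
Qed.

Lemma maximal_defect_swap l T x1 t1 x3 t3 :
  maximal_defect l T x1 t1 x3 t3 -> maximal_defect (1 - l) T x3 t3 x1 t1.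
Proof.
move=> H y1 s1 y3 s3 cy1 s10 s1T cy3 s30 s3T.
by rewrite defect_swap -(subKr 1 l) in H *; rewrite defect_swap; exact: H.
Qed.

Lemma mix_swap l x1 x3 : l *: x1 + (1 - l) *: x3 = (1 - l) *: x3 + (1 - (1 - l)) *: x1.
Proof. by rewrite subKr addrC. Qed.

Lemma mix_interior l x1 x3 : 0 < l < 1 -> closure Omega x1 -> Omega x3 ->
  Omega (l *: x1 + (1 - l) *: x3).
Proof.
move=> /andP[l0 l1] cx1 Ox3; rewrite mix_swap.
apply: (open_convex_mix (sol_open sol)) => //.
by rewrite subr_gt0 l1 gtrBl.
Qed.

Lemma superlinear (c mu L : R) : 0 < c -> mu < 1 ->
  \forall h \near (0 : R)^'+, L * h < c * h `^ mu.
Proof.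
move=> c0 mu1.
have mu0 : 0 < 1 - mu by rewrite subr_gt0.
have L0 : 0 < `|L| + 1 by rewrite ltr_wpDl.
have d0 : 0 < c / (`|L| + 1) by rewrite divr_gt0.
near=> h.
have h0 : 0 < h by near: h; exact: nbhs_right_gt.
have hd : h `^ (1 - mu) < c / (`|L| + 1).
  by near: h; exact: (cvgr_lt 0 (powR_cvg0 mu0)).
have -> : L * h = L * h `^ (1 - mu) * h `^ mu.
  rewrite -mulrA -powRD; last by rewrite (gt_eqF h0); apply/implyP.
  by rewrite subrK powRr1// ltW.
rewrite ltr_pM2r ?powR_gt0//.
apply: (@le_lt_trans _ _ ((`|L| + 1) * h `^ (1 - mu))).
  by rewrite ler_wpM2r ?powR_ge0// (le_trans (ler_norm L))// lerDl.
by rewrite mulrC -ltr_pdivlMr.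
Unshelve. all: by end_near.
Qed.

Let steep_arithmetic l L1 L2 d e h A B D D' w p :
  (1 - l) * (- (L1 * (d * h))) <= (1 - l) * (A - B) -> D' - D <= L2 * (l * e * h) ->
  ((1 - l) * L1 * d + L2 * (l * e)) * h < w -> w <= p ->
  p + (1 - l) * A - D' <= (1 - l) * B - D -> False.
Proof. by lra. Qed.

(** Moving the first point in its steep direction gains at least [l c h^mu] with [mu < 1]. The other
    two points are interior, where [V] is differentiable, so the loss there is linear in [h] and the
    defect increases. *)
Lemma maximal_defect_steep l T x1 t1 x3 t3 : 0 < l < 1 ->
  closure Omega x1 -> 0 <= t1 -> t1 <= T -> boundary Omega x1 \/ t1 = 0 ->
  Omega x3 -> 0 < t3 -> t3 <= T -> ~ maximal_defect l T x1 t1 x3 t3.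
Proof.
move=> ll cx1 t10 t1T bad Ox3 t30 t3T Hmax.
have [l0 l1] := andP ll; have l'0 : 0 < 1 - l by rewrite subr_gt0.
have Ox2 := mix_interior ll cx1 Ox3.
set x2 := l *: x1 + _ in Ox2; set t2 := l * t1 + (1 - l) * t3.
have t20 : 0 < t2 by rewrite ltr_wpDl ?mulr_gt0// mulr_ge0// ltW.
have [k [e [kappa [c [mu [c0 mu1 k0 kt Hs]]]]]] := steep_boundary cx1 t10 bad.
(* The third point moves back in time at this speed, which keeps the middle time [t2] fixed; the
   middle point moves in space only. *)
pose d := l / (1 - l) * kappa.
have d0 : 0 <= d by rewrite mulr_ge0// divr_ge0// ltW.
have [L1 [L10 HL1]] := is_derive_local_lip (rescaled_is_derive Ox3 t30).
have [L2 [L20 HL2]] := is_derive_local_lip (twice_diff_is_derive (rescaled_twice_diff k Ox2 t20)).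
have scaled (b : R) (P : R -> Prop) : (\forall r \near (0 : R), P r) ->
    \forall h \near (0 : R)^'+, P (b * h).
  move=> HP; have cb : (b * h @[h --> (0 : R)^'+]) --> (0 : R).
    rewrite -[X in _ --> X](mulr0 b); apply: cvgMr.
    by apply: cvg_at_right_filter; exact: cvg_id.
  exact: (cb _ HP).
have HL1' := scaled (- d) _ HL1; have HL2' := scaled (l * e) _ HL2.
have Hlin (b r : R) : 0 <= b -> 0 < r -> \forall h \near (0 : R)^'+, b * h <= r.
  rewrite le_eqVlt => /predU1P[<- r0|b0 r0].
    by apply: filterE => h; rewrite mul0r ltW.
  near=> h; rewrite mulrC -ler_pdivlMr//; near: h; apply: nbhs_right_le.
  exact: divr_gt0.
have Hsup := superlinear ((1 - l) * L1 * d + L2 * (l * `|e|)) (mulr_gt0 l0 c0) mu1.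
near (0 : R)^'+ => h.
have h0 : 0 < h by near: h; exact: nbhs_right_gt.
have [cy Vy] : closure Omega (x1 + (h * e) *: delta_mx ord0 k) /\
  c * h `^ mu <= V (x1 + (h * e) *: delta_mx ord0 k) (t1 + kappa * h) by near: h.
(* A forward motion in time occurs only for [t1 = 0], which leaves room below [T]. *)
have kh : kappa * h <= T - t1.
  case: kt => [->|t1e]; first by rewrite mul0r subr_ge0.
  rewrite t1e subr0; near: h; apply: Hlin => //; exact: lt_le_trans t3T.
have dh : d * h <= t3 by near: h; exact: Hlin.
have N1 : `|V x3 (t3 + - d * h) - V x3 t3| <= L1 * `|- d * h| by near: h.
have N2 : `|along k (fun y => V y t2) x2 (0 + l * e * h) - along k (fun y => V y t2) x2 0|
   <= L2 * `|l * e * h| by near: h.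
have N3 : ((1 - l) * L1 * d + L2 * (l * `|e|)) * h < l * (c * h `^ mu) by rewrite mulrA; near: h.
have kh0 : 0 <= kappa * h by rewrite mulr_ge0// ltW.
have dh0 : 0 <= d * h by rewrite mulr_ge0// ltW.
have H1 : 0 <= t1 + kappa * h by rewrite addr_ge0.
have H2 : t1 + kappa * h <= T by rewrite -lerBrDl.
have H3 : 0 <= t3 + - d * h by rewrite mulNr subr_ge0.
have H4 : t3 + - d * h <= T by rewrite mulNr (le_trans _ t3T)// gerBl.
have := Hmax _ _ _ _ cy H1 H2 (subset_closure Ox3) H3 H4.
rewrite /defect (rescaled_eq0 cx1 t10 bad) mulr0 add0r.
have -> : l * (t1 + kappa * h) + (1 - l) * (t3 + - d * h) = t2.
  by rewrite /t2 /d; field; rewrite gt_eqF.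
have -> : l *: (x1 + (h * e) *: delta_mx ord0 k) + (1 - l) *: x3 =
    x2 + (0 + l * e * h) *: delta_mx ord0 k.
  by rewrite add0r scalerDr scalerA addrAC; congr (_ + _ *: _); ring.
rewrite -/x2 -/t2.
move: N2; rewrite /along scale0r addr0 !normrM (gtr0_norm l0) (gtr0_norm h0).
move: N1; rewrite normrM normrN (gtr0_norm h0) (ger0_norm d0).
move=> /lerNnormlW N1 /(le_trans (ler_norm _)) N2.
have N1' := ler_wpM2l (ltW l'0) N1.
have N4 : l * (c * h `^ mu) <= l * V (x1 + (h * e) *: delta_mx ord0 k) (t1 + kappa * h).
  by rewrite ler_pM2l.
exact: steep_arithmetic N1' N2 N3 N4.
Unshelve. all: by end_near.
Qed.

Lemma defect_along k l x1 t1 x3 t3 (h1 h3 : R) :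
  defect l (x1 + h1 *: delta_mx ord0 k) t1 (x3 + h3 *: delta_mx ord0 k) t3 =
  l * along k (fun y => V y t1) x1 h1 + (1 - l) * along k (fun y => V y t3) x3 h3
  - along k (fun y => V y (l * t1 + (1 - l) * t3)) (l *: x1 + (1 - l) *: x3)
      (l * h1 + (1 - l) * h3).
Proof.
rewrite /defect /along.
have -> : l *: (x1 + h1 *: delta_mx ord0 k) + (1 - l) *: (x3 + h3 *: delta_mx ord0 k) =
  l *: x1 + (1 - l) *: x3 + (l * h1 + (1 - l) * h3) *: delta_mx ord0 k.
  by rewrite !scalerDr !scalerA addrACA -scalerDl.
by [].
Qed.

Let cancel_middle (A B C D E : R) : A + E - C <= B + E - D -> A + -1 * C <= B + -1 * D.
Proof. by lra. Qed.

(** * Necessary conditions at an interior maximum of the defect *)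

Section interior_maximum.
Context {l T : R} {x1 x3 : 'rV[R]_n} {t1 t3 : R}.
Hypotheses (ll : 0 < l < 1) (Ox1 : Omega x1) (Ox3 : Omega x3) (t10 : 0 < t1)
  (t1T : t1 <= T) (t30 : 0 < t3) (t3T : t3 <= T).
Hypothesis Hmax : maximal_defect l T x1 t1 x3 t3.

Let x2 := l *: x1 + (1 - l) *: x3.
Let t2 := l * t1 + (1 - l) * t3.
Let l0 : 0 < l. Proof. by case/andP: ll. Qed.
Let l'0 : 0 < 1 - l. Proof. by rewrite subr_gt0; case/andP: ll. Qed.
Let Ox2 : Omega x2. Proof. exact: mix_interior (subset_closure Ox1) Ox3. Qed.
Let t20 : 0 < t2. Proof. by rewrite addr_gt0 ?mulr_gt0. Qed.

(** Only the first point moves, backwards in time since [t1] may equal [T]; the middle time then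
    moves [l] times as fast, and the common factor [l] cancels. *)
Lemma interior_maximum_time : timeV x2 t2 <= timeV x1 t1.
Proof.
have D1 := rescaled_is_derive Ox1 t10; have D2 := rescaled_is_derive Ox2 t20.
pose w := (1 - l) * V x3 t3; pose c := (1 - l) * t3.
have Da : is_derive t1 1 (fun r : R => l * r + c) l.
  have := is_deriveD (is_deriveZ l (is_derive_id t1 (1 : R))) (is_derive_cst c t1 (1 : R)).
  by rewrite addr0 /GRing.scale /= mulr1.
have DV : is_derive t1 1 (fun r : R => V x2 (l * r + c)) (timeV x2 t2 * l).
  exact: (@is_derive1_comp _ (V x2) (fun r : R => l * r + c) t1 _ _ D2 Da).
have Df : is_derive t1 1 (fun r : R => l * V x1 r + w - V x2 (l * r + c))
    (l * timeV x1 t1 - timeV x2 t2 * l).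
  have := is_deriveB (is_deriveD (is_deriveZ l D1) (is_derive_cst w t1 (1 : R))) DV.
  by rewrite addr0.
have : 0 <= l * timeV x1 t1 - timeV x2 t2 * l.
  apply: (is_derive_left_max Df); near=> h.
  have h0 : 0 <= h by near: h; exact: nbhs_right_ge.
  have ht : h <= t1 by near: h; exact: nbhs_right_le.
  apply: (Hmax (subset_closure Ox1) _ _ (subset_closure Ox3) (ltW t30) t3T).
    by rewrite subr_ge0.
  by rewrite (le_trans _ t1T)// gerBl.
by rewrite [timeV x2 t2 * l]mulrC -mulrBr pmulr_rge0// subr_ge0.
Unshelve. all: by end_near.
Qed.

Lemma interior_maximum_grad k : gradV x1 t1 k = gradV x2 t2 k.
Proof.
have T1 := twice_diffZ l (rescaled_twice_diff k Ox1 t10).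
have T2 := twice_diffZ (-1) (twice_diff_scale l (rescaled_twice_diff k Ox2 t20)).
have [|] := twice_diff_max (twice_diffD T1 T2).
  have := near_along k (sol_open sol) Ox1; apply: filterS => h Oh.
  have := Hmax (subset_closure Oh) (ltW t10) t1T (subset_closure Ox3) (ltW t30) t3T.
  have := defect_along k l x1 t1 x3 t3 h 0; rewrite scale0r addr0 mulr0 addr0 => ->.
  have := defect_along k l x1 t1 x3 t3 0 0; rewrite !scale0r !addr0 !mulr0 addr0 => ->.
  exact: cancel_middle.
rewrite mulN1r => /eqP; rewrite subr_eq0 => /eqP /(mulfI (lt0r_neq0 l0)) -> _.
by [].
Qed.

(** The outer points move along axis [k] with speeds [v1] and [v3], hence the middle one with their
    mean. The speeds are free here and become the values of [V] later. *)
Lemma interior_maximum_hess k (v1 v3 : R) :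
  l * (v1 ^+ 2 * hessV x1 t1 k) + (1 - l) * (v3 ^+ 2 * hessV x3 t3 k)
  - (l * v1 + (1 - l) * v3) ^+ 2 * hessV x2 t2 k <= 0.
Proof.
have T1 := twice_diffZ l (twice_diff_scale v1 (rescaled_twice_diff k Ox1 t10)).
have T3 := twice_diffZ (1 - l) (twice_diff_scale v3 (rescaled_twice_diff k Ox3 t30)).
have T2 := twice_diffZ (-1) (twice_diff_scale (l * v1 + (1 - l) * v3) (rescaled_twice_diff k Ox2 t20)).
have [|_] := twice_diff_max (twice_diffD (twice_diffD T1 T3) T2); last by rewrite mulN1r.
have near_scaled (b : R) x : Omega x ->
    \forall h \near (0 : R), Omega (x + (b * h) *: delta_mx ord0 k).
  move=> Ox; have cb : (b * h @[h --> (0 : R)]) --> (0 : R).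
    by rewrite -[X in _ --> X](mulr0 b); apply: cvgMr; exact: cvg_id.
  exact: (cb _ (near_along k (sol_open sol) Ox)).
have N1 := near_scaled v1 _ Ox1; have N3 := near_scaled v3 _ Ox3.
near=> h.
have Oh1 : Omega (x1 + (v1 * h) *: delta_mx ord0 k) by near: h.
have Oh3 : Omega (x3 + (v3 * h) *: delta_mx ord0 k) by near: h.
have := Hmax (subset_closure Oh1) (ltW t10) t1T (subset_closure Oh3) (ltW t30) t3T.
rewrite defect_along.
have := defect_along k l x1 t1 x3 t3 0 0; rewrite !scale0r !addr0 !mulr0 addr0 => ->.
have -> : l * (v1 * h) + (1 - l) * (v3 * h) = (l * v1 + (1 - l) * v3) * h by ring.
by rewrite !mulN1r.
Unshelve. all: by end_near.
Qed.

End interior_maximum.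

Let sum_combination (A B C : 'I_n -> R) (l l' c1 c3 c2 : R) :
  \sum_(k < n) (l * (c1 * A k) + l' * (c3 * B k) - c2 * C k) =
  l * (c1 * \sum_(k < n) A k) + l' * (c3 * \sum_(k < n) B k) - c2 * \sum_(k < n) C k.
Proof. by rewrite sumrB big_split /= -!mulr_sumr. Qed.

Lemma maximal_defect_interior l T x1 t1 x3 t3 : 0 < l < 1 ->
  Omega x1 -> 0 < t1 -> t1 <= T -> Omega x3 -> 0 < t3 -> t3 <= T ->
  maximal_defect l T x1 t1 x3 t3 -> defect l x1 t1 x3 t3 <= 0.
Proof.
move=> ll Ox1 t10 t1T Ox3 t30 t3T Hmax.
have ll' : 0 < 1 - l < 1 by case/andP: ll => l0 l1; rewrite subr_gt0 l1 gtrBl.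
(* The swapped maximum yields the conditions relating the third point to the middle one. *)
have Hmax' := maximal_defect_swap Hmax.
have Ox2 := mix_interior ll (subset_closure Ox1) Ox3.
have t20 : 0 < l * t1 + (1 - l) * t3.
  by case/andP: ll => l0 l1; case/andP: ll' => l0' _; rewrite addr_gt0 ?mulr_gt0.
have time1 := interior_maximum_time ll Ox1 Ox3 t10 t1T t30 t3T Hmax.
have time3 := interior_maximum_time ll' Ox3 Ox1 t30 t3T t10 t1T Hmax'.
have grad1 := interior_maximum_grad ll Ox1 Ox3 t10 t1T t30 t3T Hmax.
have grad3 := interior_maximum_grad ll' Ox3 Ox1 t30 t3T t10 t1T Hmax'.
have E2x : (1 - l) *: x3 + (1 - (1 - l)) *: x1 = l *: x1 + (1 - l) *: x3.
  by rewrite -mix_swap.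
have E2t : (1 - l) * t3 + (1 - (1 - l)) * t1 = l * t1 + (1 - l) * t3.
  by rewrite subKr; exact: addrC.
rewrite E2x E2t in time3 grad3.
have hess := interior_maximum_hess ll Ox1 Ox3 t10 t1T t30 t3T Hmax.
rewrite /defect subr_le0.
set x2 := l *: x1 + _ in Ox2 time1 time3 grad1 grad3 hess *.
set t2 := l * t1 + _ in t20 time1 time3 grad1 grad3 hess *.
set P := \sum_(k < n) gradV x2 t2 k ^+ 2.
have P1 : \sum_(k < n) gradV x1 t1 k ^+ 2 = P by apply: eq_bigr => k _; rewrite grad1.
have P3 : \sum_(k < n) gradV x3 t3 k ^+ 2 = P by apply: eq_bigr => k _; rewrite grad3.
have E1 := rescaled_equation Ox1 t10; have E2 := rescaled_equation Ox2 t20.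
have E3 := rescaled_equation Ox3 t30.
rewrite P1 in E1; rewrite -/P in E2; rewrite P3 in E3.
have P0 : 0 <= P by apply: sumr_ge0 => k _; exact: sqr_ge0.
have a20 : 0 < a x2 := lt_le_trans (sol_m sol) (sol_a sol Ox2).
have bb : 1 <= beta <= 2 by rewrite beta1 ltW.
have aa : 0 < alpha <= 1 by rewrite alpha0.
have Ha := source_concave ll Ox1 Ox3 t10 t30 (rescaled_gt0 Ox1 t10) (rescaled_gt0 Ox3 t30).
apply: (concavity_max_contradiction aa bb g0 omega0 ll P0 (rescaled_gt0 Ox1 t10) (rescaled_gt0 Ox2 t20)
  (rescaled_gt0 Ox3 t30) t10 t30 a20 (rescaled_time_ge0 Ox2 t20) time1 time3 E1 E2 E3 Ha).
have := sumr_le0 (index_enum 'I_n) (P := predT) (fun k _ => hess k (V x1 t1) (V x3 t3)).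
by rewrite sum_combination.
Qed.

(** The defect attains its maximum over pairs in the cylinder up to [T]. Two interior points give a
    nonpositive maximum, exactly one point on the parabolic boundary is excluded by steepness, and
    with both there the two outer values of [V] vanish. *)
Lemma rescaled_concave l x1 t1 x3 t3 : 0 < l < 1 ->
  closure Omega x1 -> 0 <= t1 -> closure Omega x3 -> 0 <= t3 ->
  l * V x1 t1 + (1 - l) * V x3 t3 <= V (l *: x1 + (1 - l) *: x3) (l * t1 + (1 - l) * t3).
Proof.
move=> ll cx1 t10 cx3 t30.
have [l0 l1] := andP ll; have l'0 : 0 < 1 - l by rewrite subr_gt0.
have ll' : 0 < 1 - l < 1 by rewrite l'0 gtrBl.
have l01 : 0 <= l <= 1 by rewrite !ltW.
pose T := Num.max t1 t3.
have t1T : t1 <= T by rewrite le_max lexx.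
have t3T : t3 <= T by rewrite le_max lexx orbT.
pose K := cylinder_upto Omega T `*` cylinder_upto Omega T.
pose C (p : ('rV[R]_n * R) * ('rV[R]_n * R)) := defect l p.1.1 p.1.2 p.2.1 p.2.2.
have cK : compact K by apply: compact_setX; apply: compact_cylinder; exact: sol_bounded sol.
have K0 : K !=set0.
  by exists ((x1, t1), (x3, t3)); split; split => //=; rewrite in_itv /= ?t10 ?t30.
have cC : {within K, continuous C}.
  have cV (phi : ('rV[R]_n * R) * ('rV[R]_n * R) -> 'rV[R]_n * R) : continuous phi ->
      (forall p, K p -> cylinder Omega (phi p)) ->
      {within K, continuous (fun p => V (phi p).1 (phi p).2)}.
    move=> cphi Kphi; apply: (within_continuous_comp_in rescaled_within_continuous) => //.
    exact: continuous_subspaceT.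
  have cst_c (c : R) : {within K, continuous (fun=> c)}.
    by apply: continuous_subspaceT => p; exact: cvg_cst.
  apply: within_continuousB.
    apply: within_continuousD; apply: within_continuousM => //.
      by apply: (cV fst) => [p|p [/cylinder_uptoW]//]; exact: cvg_fst.
    by apply: (cV snd) => [p|p [_ /cylinder_uptoW]//]; exact: cvg_snd.
  apply: (cV (fun p => (l *: p.1.1 + (1 - l) *: p.2.1, l * p.1.2 + (1 - l) * p.2.2))).
    exact: mix_continuous.
  move=> [[z1 r1] [z3 r3]] [/cylinder_uptoW[/= cz1 r10] /cylinder_uptoW[/= cz3 r30]].
  split => /=; first exact: closure_convex.
  by rewrite addr_ge0// mulr_ge0// ltW.
have [[[y1 s1] [y3 s3]]] := compact_EVT_max K0 cK cC.
rewrite inE => -[[/= cy1]]; rewrite in_itv /= => /andP[s10 s1T] [/= cy3].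
rewrite in_itv /= => /andP[s30 s3T] HC.
have Hmax : maximal_defect l T y1 s1 y3 s3.
  move=> z1 r1 z3 r3 cz1 r10 r1T cz3 r30 r3T; apply: (HC ((z1, r1), (z3, r3))).
  by rewrite inE; split; split => //=; rewrite in_itv /= ?r10 ?r30.
rewrite -subr_le0; apply: le_trans (Hmax _ _ _ _ cx1 t10 t1T cx3 t30 t3T) _.
have good y s : closure Omega y -> 0 <= s ->
    (Omega y /\ 0 < s) \/ (boundary Omega y \/ s = 0).
  move=> cy; rewrite le_eqVlt => /predU1P[<-|s0]; first by right; right.
  by have [Oy|by_] := closure_boundary (sol_open sol) cy; [left|right; left].
have [[Oy1 s10']|bad1] := good _ _ cy1 s10; have [[Oy3 s30']|bad3] := good _ _ cy3 s30.
- exact: maximal_defect_interior Hmax.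
- have := maximal_defect_swap Hmax.
  by move=> /(maximal_defect_steep ll' cy3 s30 s3T bad3 Oy1 s10' s1T).
- by have := maximal_defect_steep ll cy1 s10 s1T bad1 Oy3 s30' s3T Hmax.
- rewrite /defect (rescaled_eq0 cy1 s10 bad1) (rescaled_eq0 cy3 s30 bad3).
  by rewrite !mulr0 add0r sub0r oppr_le0 rescaled_ge0.
Qed.

End concavity.

(** * The limit exponent two, and concavity in the form of [alpha_concave] *)

Section exponent_two.
Context {R : realType} {n : nat} {Omega : set 'rV[R]_n} {q gamma m : R}
  {a : 'rV[R]_n -> R} {u : 'rV[R]_n -> R -> R}.
Hypothesis sol : positive_solution Omega q gamma m a u.
Hypothesis n_gt0 : (0 < n)%N.
Hypothesis Omega_convex : convex_set (Omega : set (convex_lmodType 'rV[R]_n)).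
Hypothesis Omega_sphere : interior_sphere Omega.
Context {omega : R}.
Hypothesis omega0 : 0 <= omega.

Let gamma0 : 0 <= gamma. Proof. by case/andP: (sol_gamma sol). Qed.

Let W (b : R) x t := rescaled (u := u) ((1 - q) / (2 + b * gamma + omega)) b x t.

(** On the parabolic boundary the function vanishes for all exponents near [b], which stay above 1.
    Elsewhere [u] is positive, and the power is an exponential of continuous functions of the
    exponent. *)
Lemma rescaled_continuous_exponent b x t : 1 < b -> closure Omega x -> 0 <= t ->
  {for b, continuous (fun b' => W b' x t)}.
Proof.
move=> b1 cx t0.
have bad (P : boundary Omega x \/ t = 0) : {for b, continuous (fun b' => W b' x t)}.
  have E : W b x t = 0 := rescaled_eq0 sol (ltW b1) omega0 cx t0 P.
  suff : W b' x t @[b' --> b] --> W b x t by [].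
  rewrite E; apply: cvg_near_cst; near=> b'.
  apply: (rescaled_eq0 sol _ omega0 cx t0 P).
  near: b'; exact: (cvgr_ge b (@cvg_id _ (nbhs b))).
have [Ox|bx] := closure_boundary (sol_open sol) cx; last by apply: bad; left.
move: t0; rewrite le_eqVlt => /predU1P[t0|t0]; first by apply: bad; right.
have Upos b' : 0 < u x (t `^ b') by rewrite (sol_pos sol)// powR_gt0.
have -> : (fun b' => W b' x t) =
    (fun b' => expR ((1 - q) / (2 + b' * gamma + omega) * ln (u x (t `^ b')))).
  by apply/funext => b'; rewrite /W /rescaled /powR gt_eqF// Upos.
have den : 2 + b * gamma + omega != 0.
  by rewrite gt_eqF// -addrA ltr_pwDl// addr_ge0// mulr_ge0// ltW// (lt_trans ltr01).
have ct : {for b, continuous (fun b' => t `^ b')}.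
  have -> : (fun b' => t `^ b') = (fun b' => expR (b' * ln t)).
    by apply/funext => b'; rewrite /powR gt_eqF.
  apply: (@continuous_comp _ _ _ (fun b' : R => b' * ln t) expR b); last exact: continuous_expR.
  by apply: (cvgMl (F := nbhs b)); exact: cvg_id.
have cu : {for b, continuous (fun b' => u x (t `^ b'))}.
  apply: (@continuous_comp _ _ _ (fun b' : R => t `^ b') (u x) b); first exact: ct.
  apply/differentiable_continuous/derivable1_diffP.
  by apply: (sol_C1t sol) => //; exact: powR_gt0.
apply: (@continuous_comp _ _ _
  (fun b' : R => (1 - q) / (2 + b' * gamma + omega) * ln (u x (t `^ b'))) expR b);
  last exact: continuous_expR.
apply: (cvgM (F := nbhs b)).
  apply: (cvgMr (F := nbhs b)); apply: (cvgV (F := nbhs b)) => //.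
  apply: (cvgD (F := nbhs b)); last exact: cvg_cst.
  apply: (cvgD (F := nbhs b)); first exact: cvg_cst.
  by apply: (cvgMl (F := nbhs b)); exact: cvg_id.
apply: (@continuous_comp _ _ _ (fun b' : R => u x (t `^ b')) (@ln R) b); first exact: cu.
exact: continuous_ln.
Unshelve. all: by end_near.
Qed.

(** The source inequality is asked for every [g] up to [b * gamma], because [b = 2] is reached
    through smaller exponents [b'], each with its own [g = b' * gamma]. *)
Lemma rescaled_concave_le2 b : 1 <= b <= 2 ->
  (forall g l x1 x3 (t1 t3 v1 v3 : R), 0 <= g -> g <= b * gamma -> 0 < l < 1 ->
    Omega x1 -> Omega x3 -> 0 < t1 -> 0 < t3 -> 0 < v1 -> 0 < v3 ->
    l * (a x1 * t1 `^ g * v1 `^ (1 - g - omega)) +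
    (1 - l) * (a x3 * t3 `^ g * v3 `^ (1 - g - omega)) <=
    a (l *: x1 + (1 - l) *: x3) * (l * t1 + (1 - l) * t3) `^ g *
      (l * v1 + (1 - l) * v3) `^ (1 - g - omega)) ->
  forall l x1 t1 x3 t3, 0 < l < 1 ->
  closure Omega x1 -> 0 <= t1 -> closure Omega x3 -> 0 <= t3 ->
  l * W b x1 t1 + (1 - l) * W b x3 t3 <= W b (l *: x1 + (1 - l) *: x3) (l * t1 + (1 - l) * t3).
Proof.
move=> /andP[b1 b2] Ha l x1 t1 x3 t3 ll cx1 t10 cx3 t30.
have lt2 b' : 1 <= b' -> b' <= b -> b' < 2 ->
   l * W b' x1 t1 + (1 - l) * W b' x3 t3 <= W b' (l *: x1 + (1 - l) *: x3) (l * t1 + (1 - l) * t3).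
  move=> b'1 b'b b'2.
  apply: (rescaled_concave sol n_gt0 Omega_convex Omega_sphere b'1 b'2 omega0) => //.
  move=> l' y1 y3 s1 s3 v1 v3; apply: Ha; first by rewrite mulr_ge0// (le_trans ler01).
  by rewrite ler_wpM2r.
move: b2; rewrite le_eqVlt => /predU1P[b2|]; last exact: lt2.
have [l0 l1] := andP ll; have l'0 : 0 < 1 - l by rewrite subr_gt0.
have cx2 : closure Omega (l *: x1 + (1 - l) *: x3) by apply: closure_convex => //; rewrite !ltW.
have t20 : 0 <= l * t1 + (1 - l) * t3 by rewrite addr_ge0// mulr_ge0// ltW.
have b11 : 1 < b by rewrite b2 ltr1n.
(* A strict violation at [b = 2] would persist for [b'] slightly below 2, by continuity. *)
rewrite -subr_ge0 leNgt; apply/negP => neg.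
pose f b' := W b' (l *: x1 + (1 - l) *: x3) (l * t1 + (1 - l) * t3)
  - (l * W b' x1 t1 + (1 - l) * W b' x3 t3).
have cf : {for b, continuous f}.
  apply: (cvgB (F := nbhs b)); first exact: rescaled_continuous_exponent.
  apply: (cvgD (F := nbhs b)); apply: (cvgMr (F := nbhs b)); exact: rescaled_continuous_exponent.
have fneg : \forall b' \near b^'-, f b' < 0.
  exact: (cvgr_lt _ (cvg_at_left_filter cf)).
near b^'- => b'.
have b'b : b' < b by near: b'; exact: nbhs_left_lt.
have b'1 : 1 < b' by near: b'; exact: nbhs_left_gt.
have : f b' < 0 by near: b'.
rewrite ltNge /f subr_ge0 lt2 ?ltW//.
by rewrite -b2.
Unshelve. all: by end_near.
Qed.

Lemma rescaled_alpha_concave b : 1 <= b <= 2 ->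
  (forall g l x1 x3 (t1 t3 v1 v3 : R), 0 <= g -> g <= b * gamma -> 0 < l < 1 ->
    Omega x1 -> Omega x3 -> 0 < t1 -> 0 < t3 -> 0 < v1 -> 0 < v3 ->
    l * (a x1 * t1 `^ g * v1 `^ (1 - g - omega)) +
    (1 - l) * (a x3 * t3 `^ g * v3 `^ (1 - g - omega)) <=
    a (l *: x1 + (1 - l) *: x3) * (l * t1 + (1 - l) * t3) `^ g *
      (l * v1 + (1 - l) * v3) `^ (1 - g - omega)) ->
  alpha_concave ((1 - q) / (2 + b * gamma + omega))
    (closure Omega `*` [set t : R^o | 0 <= t])
    (fun p : 'rV[R]_n * R^o => u p.1 (p.2 `^ b)).
Proof.
move=> b12 Ha; have [b1 b2] := andP b12; split.
- case/andP: (sol_q sol) => _ q1; rewrite divr_gt0 ?subr_gt0//.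
  by rewrite -addrA ltr_pwDl// addr_ge0// mulr_ge0// (le_trans ler01).
- by move=> [x t] [/= cx t0]; rewrite (sol_ge0 sol)// powR_ge0.
move=> l [x1 t1] [x3 t3]; rewrite !inE => -[/= cx1 t10] [/= cx3 t30].
have [l0 l1] : 0 <= (l%:num : R) /\ (l%:num : R) <= 1 by [].
rewrite /= -[_ <= _]/(l%:num * W b x1 t1 + (1 - l%:num) * W b x3 t3 <=
  W b (l%:num *: x1 + (1 - l%:num) *: x3) (l%:num * t1 + (1 - l%:num) * t3)).
(* The weights 0 and 1 are trivial and are removed first. *)
move: (l%:num : R) l0 l1 => r; rewrite le_eqVlt => /predU1P[<- _|r0].
  by rewrite subr0 !mul0r !mul1r scale0r scale1r !add0r.
rewrite le_eqVlt => /predU1P[->|r1].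
  by rewrite subrr !mul0r !mul1r scale0r scale1r !addr0.
by apply: (rescaled_concave_le2 b12 Ha) => //; rewrite r0.
Qed.

End exponent_two.

(** * The two cases of the theorem: [theta]-concave and constant [a] *)

Lemma theta_concave_le {R : realType} {n : nat} (Omega : set 'rV[R]_n) (theta : R)
    (a : 'rV[R]_n -> R) : alpha_concave theta Omega a ->
  forall l x y, 0 < l < 1 -> Omega x -> Omega y ->
  l * a x `^ theta + (1 - l) * a y `^ theta <= a (l *: x + (1 - l) *: y) `^ theta.
Proof.
move=> [_ _ H] l x y /andP[l0 l1] Ox Oy.
have /= := H (Itv01 (ltW l0) (ltW l1)) x y.
by rewrite !inE => /(_ Ox Oy).
Qed.

Unset Implicit Arguments.

(* [(gamma%:E^-1)%E] is the extended-real inverse, equal to [+oo] at 0. *)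
Theorem theorem1p4 (R : realType) (n : nat) (n_ge2 : (2 <= n)%N)
  (Omega : set 'rV[R]_n)
  (Omega_domain : domain Omega)
  (Omega_bounded : bounded_set Omega)
  (Omega_convex : convex_set (Omega : set (convex_lmodType 'rV[R]_n)))
  (Omega_sphere : interior_sphere Omega)
  (q gamma : R) (q_bounds : 0 <= q < 1) (gamma_bounds : 0 <= gamma <= 1)
  (a : 'rV[R]_n -> R) (u : 'rV[R]_n -> R -> R)
  (u_C2x : forall t, 0 < t -> Ck 2 Omega (fun x => u x t))
  (u_C1x : forall t, 0 < t -> C1_closure Omega (fun x => u x t))
  (u_C1t : forall x, Omega x -> C1_pos (u x))
  (u_cont : {within closure Omega `*` [set t : R | 0 <= t],
               continuous (fun p : 'rV[R]_n * R => u p.1 p.2)})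
  (u_pos : forall x t, Omega x -> 0 < t -> 0 < u x t)
  (u_eq : forall x t, Omega x -> 0 < t ->
     derive1 (u x) t - laplacian (fun y => u y t) x
       = a x * t `^ gamma * (u x t) `^ q)
  (u_boundary : forall x t, boundary Omega x -> 0 <= t -> u x t = 0)
  (u_initial : forall x, closure Omega x -> u x 0 = 0)
  (a_measurable : lebesgue_measurable_fun Omega a)
  (a_lower : exists m : R, 0 < m /\ forall x, Omega x -> m <= a x) :
  (forall beta theta : R,
     1 <= beta -> (beta%:E < gamma%:E^-1)%E -> beta <= 2 ->
     (1 - beta * gamma)^-1 <= theta ->
     alpha_concave theta Omega a ->
     alpha_concave ((1 - q) * theta / (2 * theta + beta * gamma * theta + 1))
       (closure Omega `*` [set t : R^o | 0 <= t])
       (fun p : 'rV[R]_n * R^o => u p.1 (p.2 `^ beta))) /\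
  (forall beta : R,
     1 <= beta -> (beta%:E <= Order.min (gamma%:E^-1) 2%:E)%E ->
     (exists c : R, forall x, Omega x -> a x = c) ->
     alpha_concave ((1 - q) / (2 + beta * gamma))
       (closure Omega `*` [set t : R^o | 0 <= t])
       (fun p : 'rV[R]_n * R^o => u p.1 (p.2 `^ beta))).
Proof.
have [m [m0 am]] := a_lower.
have n0 : (0 < n)%N by exact: leq_trans n_ge2.
have [Oopen One _] := Omega_domain.
have [gamma0 gamma1] := andP gamma_bounds.
have sol : positive_solution Omega q gamma m a u.
  by split => // x t Ox t0; case: (u_C1t x Ox t t0).
split => [beta theta beta1 beta_gamma beta2 theta_ge a_concave|beta beta1 beta_le [c ac]].
- have bg1 : beta * gamma < 1.
    move: beta_gamma; rewrite inver; case: ifPn => [/eqP -> _|gn0]; first by rewrite mulr0.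
    have gp : 0 < gamma by rewrite lt_neqAle eq_sym gn0.
    by rewrite lte_fin -ltr_pdivlMr// mul1r.
  have theta0 : 0 < theta.
    by apply: lt_le_trans theta_ge; rewrite invr_gt0 subr_gt0.
  have omega0 : 0 <= theta^-1 by rewrite invr_ge0 ltW.
  have bg0 : 0 <= beta * gamma by rewrite mulr_ge0// (le_trans ler01).
  (* The lower bound on [theta], inverted: it makes the third weight [1 - g - omega] nonnegative. *)
  have omega_le : theta^-1 <= 1 - beta * gamma.
    by rewrite -[leRHS]invrK lef_pV2// posrE ?invr_gt0 ?subr_gt0.
  have -> : (1 - q) * theta / (2 * theta + beta * gamma * theta + 1) =
      (1 - q) / (2 + beta * gamma + theta^-1).
    have d1 : 0 < 2 * theta + beta * gamma * theta + 1.
      by rewrite ltr_wpDl// addr_ge0// mulr_ge0// ltW.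
    have d2 : 0 < 2 + beta * gamma + theta^-1 by rewrite -addrA ltr_pwDl// addr_ge0.
    have E : (2 + beta * gamma + theta^-1) * theta = 2 * theta + beta * gamma * theta + 1.
      by rewrite !mulrDl mulVf ?gt_eqF.
    by rewrite -E invfM mulrACA divff ?gt_eqF// mulr1.
  apply: (rescaled_alpha_concave sol n0 Omega_convex Omega_sphere omega0).
    by rewrite beta1.
  move=> g l x1 x3 t1 t3 v1 v3 g0 gb ll Ox1 Ox3 t10 t30 v10 v30.
  have a0 x : Omega x -> 0 < a x by move=> Ox; exact: lt_le_trans (am x Ox).
  have Ox2 : Omega (l *: x1 + (1 - l) *: x3).
    by apply: (open_convex_mix Oopen Omega_convex ll Ox1); exact: subset_closure.
  (* Writing [a] as the power [omega = 1 / theta] of the concave function [a^theta] makes it a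
     factor of the weighted geometric mean. *)
  have aE x : Omega x -> a x = (a x `^ theta) `^ theta^-1.
    by move=> Ox; rewrite -powRrM mulfV ?gt_eqF// powRr1// ltW// a0.
  rewrite (aE x1 Ox1) (aE x3 Ox3) (aE _ Ox2).
  have sum1 : theta^-1 + g + (1 - g - theta^-1) = 1 by ring.
  have w0 : 0 <= 1 - g - theta^-1 by move: omega_le gb; lra.
  apply: le_trans (powR3_concave omega0 g0 w0 sum1 ll (powR_gt0 theta (a0 _ Ox1)) t10 v10
    (powR_gt0 theta (a0 _ Ox3)) t30 v30) _.
  rewrite ler_wpM2r ?powR_ge0// ler_wpM2r ?powR_ge0//.
  apply: ge0_ler_powR => //; rewrite ?nnegrE ?powR_ge0//.
    by case/andP: ll => l0 l1; rewrite addr_ge0// mulr_ge0 ?powR_ge0 ?ltW// subr_gt0.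
  exact: (theta_concave_le a_concave).
have beta2 : beta <= 2 by move: beta_le; rewrite le_min => /andP[_]; rewrite lee_fin.
have bg1 : beta * gamma <= 1.
  move: beta_le; rewrite le_min inver => /andP[+ _].
  case: ifPn => [/eqP -> _|gn0]; first by rewrite mulr0.
  have gp : 0 < gamma by rewrite lt_neqAle eq_sym gn0.
  by rewrite lee_fin -ler_pdivlMr// mul1r.
(* Constant [a] is the case [omega = 0], the limit of infinite [theta]. *)
rewrite -[2 + beta * gamma]addr0.
apply: (rescaled_alpha_concave sol n0 Omega_convex Omega_sphere (lexx 0)).
  by rewrite beta1.
move=> g l x1 x3 t1 t3 v1 v3 g0 gb ll Ox1 Ox3 t10 t30 v10 v30.
have Ox2 : Omega (l *: x1 + (1 - l) *: x3).
  by apply: (open_convex_mix Oopen Omega_convex ll Ox1); exact: subset_closure.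
have c0 : 0 < c by rewrite -(ac x1 Ox1); exact: lt_le_trans (am x1 Ox1).
rewrite (ac x1 Ox1) (ac x3 Ox3) (ac _ Ox2).
have sum1 : 0 + g + (1 - g - 0) = 1 by ring.
have w0 : 0 <= 1 - g - 0 by move: bg1 gb; lra.
(* The first factor is 1 with weight 0; the constant [c] is pulled out afterwards. *)
have := powR3_concave (lexx 0) g0 w0 sum1 ll ltr01 t10 v10 ltr01 t30 v30.
rewrite !powRr0 !mul1r => H.
rewrite -!mulrA [l * (c * _)]mulrCA [(1 - l) * (c * _)]mulrCA -mulrDr.
by rewrite ler_pM2l.
Qed.
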